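(* Let $A=[A_1,\ldots,A_n]$ and $B=[B_1,\ldots,B_n]$ be in $[B(\mathcal H)^n]_1^-$, and let $V=[V_1,\ldots,V_n]$ on $\mathcal K_A\supseteq\mathcal H$ and $W=[W_1,\ldots,W_n]$ on $\mathcal K_B\supseteq\mathcal H$ be the minimal isometric dilations of $A$ and $B$, respectively. If $c\ge 1$, then the following statements are equivalent: (i) $A\overset{H}{\prec}_c B$; (ii) there is an operator $L_{B,A}\in B(\mathcal K_B,\mathcal K_A)$ with $\|L_{B,A}\|\le c$ such that $L_{B,A}|_{\mathcal H}=I_{\mathcal H}$ and $L_{B,A}W_i=V_iL_{B,A}$ for $i=1,\ldots,n$.
   Context: $n$ is a positive integer, $\mathcal H$ is a complex Hilbert space, and $B(\mathcal H)$ is the algebra of bounded linear operators on $\mathcal H$. $[B(\mathcal H)^n]_1^-$ (resp. $[B(\mathcal H)^n]_1$) is the set of $(X_1,\ldots,X_n)\in B(\mathcal H)^n$ with $\|X_1X_1^*+\cdots+X_nX_n^*\|^{1/2}\le 1$ (resp. $<1$). Harnack domination: for $A,B\in[B(\mathcal H)^n]_1^-$ and $c>0$, $A\overset{H}{\prec}_c B$ means that $\mathrm{Re}\,p(A_1,\ldots,A_n)\le c^2\,\mathrm{Re}\,p(B_1,\ldots,B_n)$ for every $m\in\mathbb N$ and every noncommutative polynomial with matrix coefficients $p\in\mathbb C[X_1,\ldots,X_n]\otimes M_m$ such that $\mathrm{Re}\,p\ge0$, i.e. $\mathrm{Re}\,p(X_1,\ldots,X_n)\ge0$ for all $(X_1,\ldots,X_n)\in[B(\mathcal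 K)^n]_1$, where $\mathcal K$ is an infinite-dimensional Hilbert space. Here $\mathrm{Re}\,T=\frac12(T+T^* )$. $\mathbb F_n^+$ is the unital free semigroup on generators $g_1,\ldots,g_n$ with identity $g_0$; for operators $V_i$, $V_\alpha:=V_{i_1}\cdots V_{i_k}$ if $\alpha=g_{i_1}\cdots g_{i_k}$ and $V_{g_0}:=I$. A minimal isometric dilation of $T\in[B(\mathcal H)^n]_1^-$ is an $n$-tuple $V=[V_1,\ldots,V_n]$ of isometries on a Hilbert space $\mathcal K_T\supseteq\mathcal H$ with $V_1V_1^*+\cdots+V_nV_n^*\le I$, $V_i^*|_{\mathcal H}=T_i^*$ for all $i$, and $\mathcal K_T=\bigvee_{\alpha\in\mathbb F_n^+}V_\alpha\mathcal H$; it exists and is unique up to an isomorphism. $L|_{\mathcal H}=I_{\mathcal H}$ means $Lh=h$ for all $h\in\mathcal H$. *)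

(* Defs.v *)
From HB Require Import structures.
From mathcomp Require Import all_boot all_order all_algebra.
From mathcomp Require Import finmap sesquilinear complex.
From mathcomp Require Import all_classical all_reals all_analysis.

Set Implicit Arguments.
Unset Strict Implicit.
Unset Printing Implicit Defensive.

Import Order.TTheory GRing.Theory Num.Theory.
Import numFieldNormedType.Exports.

Local Open Scope classical_set_scope.
Local Open Scope ring_scope.

(* Inner products are linear in the first argument and conjugate-linear in
   the second one. *)
HB.mixin Record isInnerProductSpace (R : realType) V
    of GRing.Lmodule R[i] V := {
  inner_form : {dot V for @Num.conj R[i]}
}.

#[short(type="innerProductType")]
HB.structure Definition InnerProductSpace (R : realType) :=
  {V of GRing.Lmodule R[i] V & isInnerProductSpace R V}.

Definition inner (R : realType) (V : innerProductType R) (x y : V) : R[i] :=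
  (inner_form : {dot V for Num.conj}) x y.

(* The norm of an R[i]-normed module is R[i]-valued (a nonnegative real). *)
HB.mixin Record isHilbert (R : realType) V
    of CompleteNormedModule R[i] V & InnerProductSpace R V := {
  normr_inner : forall x : V, `|x| ^+ 2 = inner x x
}.

#[short(type="hilbertType")]
HB.structure Definition Hilbert (R : realType) :=
  {V of CompleteNormedModule R[i] V & InnerProductSpace R V & isHilbert R V}.

#[short(type="boundedLinearType")]
HB.structure Definition BoundedLinear (K : numFieldType)
    (V W : normedModType K) :=
  {f of @GRing.Linear K V W *:%R f & @isContinuous V W f}.

Notation "{ 'bounded_linear' V -> W }" := (boundedLinearType V%type W%type)
  (at level 0, V at level 98, W at level 99,
   format "{ 'bounded_linear'  V  ->  W }") : type_scope.

Section DirectSum.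
Context (R : realType) (I : finType) (V : innerProductType R).
Implicit Types f g h : {ffun I -> V}.

Definition ffun_inner f g : R[i] := \sum_i inner (f i) (g i).

Lemma ffun_inner_bilinear :
  bilinear_for (GRing.Scale.Law.clone _ _ *%R _)
    (GRing.Scale.Law.clone _ _ (@Num.conj R[i] \; *%R) _) ffun_inner.
Proof.
split=> [g a f h|f a g h]; rewrite /ffun_inner /= mulr_sumr -big_split /=.
  by apply: eq_bigr => i _; rewrite !ffunE /inner linearPl.
by apply: eq_bigr => i _; rewrite !ffunE /inner linearPr.
Qed.

HB.instance Definition _ := bilinear_isBilinear.Build R[i] {ffun I -> V}
  {ffun I -> V} R[i] *%R (@Num.conj R[i] \; *%R) ffun_inner
  ffun_inner_bilinear.

Lemma ffun_inner_hermitian f g :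
  ffun_inner f g = (-1) ^+ false * Num.conj (ffun_inner g f).
Proof.
rewrite expr0 mul1r /ffun_inner rmorph_sum; apply: eq_bigr => i _.
by rewrite {1}/inner hermitian_subproof expr0 mul1r.
Qed.

HB.instance Definition _ := isHermitianSesquilinear.Build R[i]
  {ffun I -> V} false (@Num.conj R[i]) ffun_inner ffun_inner_hermitian.

Lemma ffun_inner_gt0 f : f != 0 -> 0 < ffun_inner f f.
Proof.
move=> f0; have [i fi0] : exists i, f i != 0.
  apply/existsP; apply: contraNT f0 => /existsPn fE.
  by apply/eqP/ffunP => i; rewrite ffunE; apply/eqP/negPn/fE.
have inner_ge0 j : 0 <= inner (f j) (f j).
  have [->|fj0] := eqVneq (f j) 0; first by rewrite /inner linear0l.
  exact/ltW/neq0_dnorm_gt0.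
rewrite /ffun_inner (bigD1 i) //= ltr_wpDr ?sumr_ge0 //.
exact: neq0_dnorm_gt0.
Qed.

HB.instance Definition _ := isDotProduct.Build R[i] {ffun I -> V}
  ffun_inner ffun_inner_gt0.

HB.instance Definition _ := isInnerProductSpace.Build R {ffun I -> V}
  (ffun_inner : {dot {ffun I -> V} for @Num.conj R[i]}).

End DirectSum.

Section Operators.
Context (R : realType).

(* On Hilbert spaces, every bounded linear T has exactly one adjoint (Riesz);
   the default value 0 is only reached for functions T without an adjoint. *)
Definition adjoint (V W : innerProductType R) (T : V -> W) : W -> V :=
  xget (fun=> 0) [set S | forall x y, inner (T x) y = inner x (S y)].

Definition op_pos (V : innerProductType R) (T : V -> V) : Prop :=
  forall x, 0 <= inner (T x) x.

Definition op_le (V : innerProductType R) (S T : V -> V) : Prop :=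
  op_pos (T - S).

Definition op_Re (V : innerProductType R) (T : V -> V) : V -> V :=
  fun x => 2^-1 *: (T x + adjoint T x).

Definition op_norm (V W : normedModType R[i]) (T : V -> W) : R :=
  sup [set complex.Re `|T x| | x in [set x : V | `|x| <= 1]].

Definition closed_subspace (V : normedModType R[i]) (E : set V) : Prop :=
  [/\ E 0, forall a x y, E x -> E y -> E (a *: x + y) & closed E].

Definition closed_span (V : normedModType R[i]) (S : set V) : set V :=
  smallest (@closed_subspace V) S.

Definition infinite_dimensional (V : lmodType R[i]) : Prop :=
  ~ exists (N : nat) (e : 'I_N -> V),
      forall x, exists a : 'I_N -> R[i], x = \sum_i a i *: e i.

End Operators.

Section Tuples.
Context (R : realType) (n : nat).

(* X_alpha, where the word g_{i_1} ... g_{i_k} is encoded as the sequence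
   [:: i_1; ...; i_k] and the neutral element g_0 as [::]. *)
Definition word_op (V : Type) (X : 'I_n -> V -> V) (alpha : seq 'I_n) : V -> V :=
  foldr (fun i T => X i \o T) idfun alpha.

Definition row_sq (V : innerProductType R) (X : 'I_n -> V -> V) : V -> V :=
  \sum_i (X i \o adjoint (X i)).

Definition row_norm (H : hilbertType R) (X : 'I_n -> H -> H) : R :=
  Num.sqrt (op_norm (row_sq X)).

(* C[X_1, ..., X_n] (x) M_m: finitely supported families of matrix
   coefficients indexed by words. *)
Definition ncpoly (m : nat) : Type :=
  {fsfun seq 'I_n -> 'M[R[i]]_m with 0}.

(* p(X) = \sum_alpha X_alpha (x) p_alpha, acting on V (x) C^m, i.e. on the
   direct sum V^m. *)
Definition ncpoly_eval (m : nat) (p : ncpoly m) (V : innerProductType R)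
    (X : 'I_n -> V -> V) (f : {ffun 'I_m -> V}) : {ffun 'I_m -> V} :=
  [ffun i => \sum_(alpha <- finsupp p) \sum_j
               p alpha i j *: word_op X alpha (f j)].

Definition ncpoly_Re_pos (K : hilbertType R) (m : nat) (p : ncpoly m) : Prop :=
  forall X : 'I_n -> {bounded_linear K -> K},
    row_norm X < 1 -> op_pos (op_Re (ncpoly_eval p X)).

(* The relation does not depend on the choice of the infinite-dimensional
   Hilbert space K. *)
Definition harnack_dominated (K H : hilbertType R) (c : R)
    (A B : 'I_n -> {bounded_linear H -> H}) : Prop :=
  forall (m : nat) (p : ncpoly m), ncpoly_Re_pos K p ->
    op_le (op_Re (ncpoly_eval p A))
          (fun f => (c ^+ 2)%:C%C *: op_Re (ncpoly_eval p B) f).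

(* The inclusion of H in K is an isometric linear map iota. *)
Definition minimal_isometric_dilation (H K : hilbertType R)
    (T : 'I_n -> {bounded_linear H -> H}) (iota : {linear H -> K})
    (V : 'I_n -> {bounded_linear K -> K}) : Prop :=
  [/\ forall h g, inner (iota h) (iota g) = inner h g,
      forall i x, `|V i x| = `|x|,
      op_le (row_sq V) idfun,
      forall i h, adjoint (V i) (iota h) = iota (adjoint (T i) h)
    & closed_span [set word_op V alpha (iota h) | alpha in setT & h in setT]
      = setT].

End Tuples.

(* Main.v *)
(* Both conditions are equivalent to
     |sum_w V_w h_w| <= c |sum_w W_w h_w|   for all finitely supported families (h_w) in H.
   An intertwiner gives this inequality, and conversely the inequality makes sum W_w h_w |-> sum V_w h_w extend by
   continuity to the whole of K_B.
   From Harnack domination: the multi-Toeplitz kernel on words a, b of length at most k (X_g if a = b g, X_g^* if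
   b = a g, 0 otherwise) is the real part of a matrix polynomial which is positive on row contractions, and its quadratic form at A is |sum V_w h_w|^2.
   From the intertwiner L: Q(x, y) = c^2 <x, y> - <L x, L y> is positive semidefinite with
   Q(W_i x, W_j y) = delta_ij Q(x, y), so W is a row isometry for Q and Re p >= 0 passes to Re p(W) >= 0 relative to Q, which
   on H reads c^2 Re p(B) - Re p(A) >= 0. *)

Require Import Defs.
From HB Require Import structures.
From mathcomp Require Import all_boot all_order all_algebra.
From mathcomp Require Import finmap sesquilinear complex.
From mathcomp Require Import all_classical all_reals all_analysis.
From mathcomp Require Import ring lra.

Set Implicit Arguments.
Unset Strict Implicit.
Unset Printing Implicit Defensive.

Import Order.TTheory GRing.Theory Num.Theory.
Import numFieldNormedType.Exports.

Local Open Scope ring_scope.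

(** The hypothesis Re p >= 0 speaks only of strict row contractions on the given space K, whereas
    the intertwiner yields a row isometry for a form Q on K_B, and Q may be degenerate. Neither the
    quotient by the Q-null vectors nor its completion is formed: one value of the form attached to p
    involves finitely many vectors W_w x_j, these are orthonormalised up to null vectors, and the
    compression of r W to their span, r < 1, is copied onto an orthonormal family of the same size
    in K. An infinite-dimensional K has room for it. In the other direction the kernel contains
    adjoints, which a polynomial cannot. As only real parts matter, the entries X_g^* are dropped
    and the entries X_g doubled. Positivity on row contractions is an induction on the length of
    words that splits off the first letter; for a dilation the same induction runs with
    equalities. *)

Local Notation Re := complex.Re.

(** * Real parts of complex numbers *)

Section ComplexRe.
Context (R : realType).
Implicit Types z w : R[i].

Lemma ReD z w : Re (z + w) = Re z + Re w.
Proof. by case: z w => [a b] [a' b']. Qed.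

Lemma ReN z : Re (- z) = - Re z.
Proof. by case: z. Qed.

Lemma ReB z w : Re (z - w) = Re z - Re w.
Proof. by rewrite ReD ReN. Qed.

Lemma ReC (a : R) : Re (a%:C%C : R[i]) = a.
Proof. by []. Qed.

Lemma ReMl (a : R) z : Re (a%:C%C * z) = a * Re z.
Proof. by case: z => b d /=; rewrite mul0r subr0. Qed.

Lemma Re_conj z : Re (Num.conj z) = Re z.
Proof. by case: z. Qed.

Lemma conj_realC (a : R) : Num.conj a%:C%C = a%:C%C :> R[i].
Proof. exact: conjc_real. Qed.

Lemma Re_sum (I : Type) (s : seq I) (P : pred I) (F : I -> R[i]) :
  Re (\sum_(i <- s | P i) F i) = \sum_(i <- s | P i) Re (F i).
Proof. by elim/big_rec2: _ => [|i x y _ <-]; rewrite ?ReD. Qed.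

Lemma Re_ge0 z : 0 <= z -> 0 <= Re z.
Proof. by rewrite lecE => /andP[]. Qed.

Lemma ge0_ReK z : 0 <= z -> (Re z)%:C%C = z.
Proof. by move=> z0; rewrite RRe_real // ger0_real. Qed.

Lemma mul_conj_ge0 z : exists2 N : R, 0 <= N & z * Num.conj z = N%:C%C.
Proof.
exists (Re (`|z| ^+ 2)); first by apply: Re_ge0; rewrite exprn_ge0.
by rewrite -normCK ge0_ReK // exprn_ge0.
Qed.

Lemma sqr_Re_le z : Re z ^+ 2 <= Re (`|z| ^+ 2).
Proof.
by case: z => a b; rewrite -add_Re2_Im2 /= lerDl sqr_ge0.
Qed.

Lemma addr_conj z : z + Num.conj z = (2 * Re z)%:C%C.
Proof.
by case: z => a b; apply/eqP; rewrite eq_complex /= subrr mulr2n mulrDl mul1r !eqxx.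
Qed.

End ComplexRe.

(** * Positive semidefinite forms *)

Section PositiveForm.
Context (R : realType) (V : lmodType R[i]).
Implicit Types (Q : V -> V -> R[i]) (x y z : V).

Definition psd_form Q : Prop :=
  [/\ forall a x y z, Q (a *: x + y) z = a * Q x z + Q y z,
      forall x y, Q y x = Num.conj (Q x y)
    & forall x, 0 <= Q x x].

Context Q (Q_psd : psd_form Q).

Let Qlin : forall a x y z, Q (a *: x + y) z = a * Q x z + Q y z.
Proof. by case: Q_psd. Qed.

Let QC : forall x y, Q y x = Num.conj (Q x y).
Proof. by case: Q_psd. Qed.

Lemma psd_ge0 x : 0 <= Q x x.
Proof. by case: Q_psd. Qed.

Lemma psdC x y : Q y x = Num.conj (Q x y).
Proof. exact: QC. Qed.

Lemma psdDl x y z : Q (x + y) z = Q x z + Q y z.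
Proof. by rewrite -[x in LHS]scale1r Qlin mul1r. Qed.

Lemma psd0l z : Q 0 z = 0.
Proof. by apply: (addIr (Q 0 z)); rewrite add0r -psdDl addr0. Qed.

Lemma psdZl a x z : Q (a *: x) z = a * Q x z.
Proof. by rewrite -[_ *: _]addr0 Qlin psd0l addr0. Qed.

Lemma psdNl x z : Q (- x) z = - Q x z.
Proof. by rewrite -scaleN1r psdZl mulN1r. Qed.

Lemma psdBl x y z : Q (x - y) z = Q x z - Q y z.
Proof. by rewrite psdDl psdNl. Qed.

Lemma psd_suml (I : Type) (s : seq I) (P : pred I) (F : I -> V) z :
  Q (\sum_(i <- s | P i) F i) z = \sum_(i <- s | P i) Q (F i) z.
Proof. by apply: (big_morph (Q^~ z)) => [x y|]; [exact: psdDl|exact: psd0l]. Qed.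

Lemma psdDr x y z : Q z (x + y) = Q z x + Q z y.
Proof. by rewrite QC psdDl rmorphD /= -!QC. Qed.

Lemma psd0r z : Q z 0 = 0.
Proof. by rewrite QC psd0l rmorph0. Qed.

Lemma psdZr a x z : Q z (a *: x) = Num.conj a * Q z x.
Proof. by rewrite QC psdZl rmorphM /= -QC. Qed.

Lemma psdNr x z : Q z (- x) = - Q z x.
Proof. by rewrite QC psdNl rmorphN /= -QC. Qed.

Lemma psdBr x y z : Q z (x - y) = Q z x - Q z y.
Proof. by rewrite psdDr psdNr. Qed.

Lemma psd_sumr (I : Type) (s : seq I) (P : pred I) (F : I -> V) z :
  Q z (\sum_(i <- s | P i) F i) = \sum_(i <- s | P i) Q z (F i).
Proof. by apply: (big_morph (Q z)) => [x y|]; [exact: psdDr|exact: psd0r]. Qed.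

Lemma psd_real x : Q x x = (Re (Q x x))%:C%C.
Proof. by rewrite ge0_ReK // psd_ge0. Qed.

(** If Q y y = 0, then Q at x - s t y with t = Q x y is affine in the real number s with slope -2
    |t|^2, so it stays nonnegative only for t = 0. This makes null vectors harmless without a
    quotient. *)
Lemma psd_null x y : Q y y = 0 -> Q x y = 0.
Proof.
move=> y0; set t := Q x y.
have [N N0 tN] := mul_conj_ge0 t.
suff : N <= 0.
  move=> N_le0; have /eqP : N = 0 by apply/le_anti; rewrite N_le0 N0.
  move=> /eqP N_eq0; move: tN; rewrite N_eq0 -normCK => /eqP.
  by rewrite expf_eq0 /= normr_eq0 => /eqP.
have pos (s : R) : 0 <= Re (Q x x) - 2 * s * N.
  have := Re_ge0 (psd_ge0 (x - (s%:C%C * t) *: y)).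
  rewrite psdBr !psdBl !psdZr !psdZl y0 !mulr0 subr0 [Q y x]QC -/t.
  rewrite rmorphM /=.
  rewrite (conj_realC s) -!mulrA [Num.conj t * t]mulrC tN !ReB !ReMl (ReC N) => h.
  by lra.
rewrite leNgt; apply/negP => Npos.
(* This s makes the affine function equal to - Q x x - 2 < 0. *)
have := pos ((Re (Q x x) + 1) / N).
by rewrite -mulrA divfK ?gt_eqF // mulrC; have := Re_ge0 (psd_ge0 x); lra.
Qed.

Lemma psd_cauchy x y : `|Q x y| ^+ 2 <= Q x x * Q y y.
Proof.
have [y0|y0] := eqVneq (Q y y) 0; first by rewrite (psd_null x y0) normr0 expr0n y0 mulr0.
have ypos : 0 < Q y y by rewrite lt_def y0 psd_ge0.
(* Expanded, this value is Q y y (Q x x Q y y - |Q x y|^2). *)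
have := psd_ge0 (Q y y *: x - Q x y *: y).
have yy : Num.conj (Q y y) = Q y y by rewrite -QC.
rewrite psdBr !psdBl !psdZr !psdZl yy [Q y x]QC normCK => h.
rewrite -subr_ge0 -(pmulr_rge0 _ ypos); apply: le_trans h _.
by rewrite le_eqVlt; apply/orP; left; apply/eqP; ring.
Qed.

Lemma psd_Re_cauchy x y : Re (Q x y) ^+ 2 <= Re (Q x x) * Re (Q y y).
Proof.
apply: le_trans (sqr_Re_le _) _; have := psd_cauchy x y.
rewrite (psd_real x) (psd_real y) -rmorphM /= lecE => /andP[_ h]; exact: h.
Qed.

Lemma psd_pythag x y : Re (Q (x + y) (x + y)) =
  Re (Q x x) + 2 * Re (Q x y) + Re (Q y y).
Proof.
by rewrite psdDr !psdDl [Q y x]QC !ReD Re_conj; ring.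
Qed.

Definition orthonormal_family (I : finType) (e : I -> V) : Prop :=
  forall i j, Q (e i) (e j) = (i == j)%:R.

Definition orthoproj (I : finType) (e : I -> V) x : V := \sum_i Q x (e i) *: e i.

Lemma orthoproj_pair (I : finType) (e : I -> V) x j :
  orthonormal_family e -> Q (orthoproj e x) (e j) = Q x (e j).
Proof.
move=> oe; rewrite psd_suml (bigD1 j) //= psdZl oe eqxx mulr1 big1 ?addr0 // => i ij.
by rewrite psdZl oe (negbTE ij) mulr0.
Qed.

Lemma orthoproj_pairr (I : finType) (e : I -> V) x y :
  Q y (orthoproj e x) = \sum_i Q y (e i) * Num.conj (Q x (e i)).
Proof. by rewrite psd_sumr; apply: eq_bigr => i _; rewrite psdZr mulrC. Qed.

Lemma psd_bessel (I : finType) (e : I -> V) x :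
  orthonormal_family e -> \sum_i `|Q x (e i)| ^+ 2 <= Q x x.
Proof.
move=> oe; have := psd_ge0 (x - orthoproj e x).
have E : Q x (orthoproj e x) = \sum_i `|Q x (e i)| ^+ 2.
  by rewrite orthoproj_pairr; apply: eq_bigr => i _; rewrite normCK.
have Epp : Q (orthoproj e x) (orthoproj e x) = \sum_i `|Q x (e i)| ^+ 2.
  by rewrite orthoproj_pairr; apply: eq_bigr => i _; rewrite orthoproj_pair // normCK.
have Epx : Q (orthoproj e x) x = \sum_i `|Q x (e i)| ^+ 2.
  by rewrite QC E rmorph_sum; apply: eq_bigr => i _; rewrite normCK rmorphM /= conjCK mulrC.
by rewrite psdBr !psdBl E Epp Epx subrr subr0 subr_ge0.
Qed.

(** One Gram-Schmidt step: the residual z is normalised to u = z / s and appended at [ord_max]. As Q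
    x u = s, the enlarged expansion reproduces x exactly, not merely up to a null vector. *)
Lemma orthonormal_extend (d : nat) (e : 'I_d -> V) x :
  orthonormal_family e ->
  Q (x - orthoproj e x) (x - orthoproj e x) != 0 ->
  exists (e' : 'I_d.+1 -> V), [/\ orthonormal_family e',
    forall i, e' (lift ord_max i) = e i
    & x - orthoproj e' x = 0].
Proof.
move=> oe z0; set z := x - orthoproj e x in z0 *.
have ze i : Q z (e i) = 0 by rewrite psdBl orthoproj_pair // subrr.
have [s [s0 sr ss]] : exists s, [/\ s != 0, Num.conj s = s & s ^+ 2 = Q z z].
  exists (sqrtC (Q z z)); split; [by rewrite sqrtC_eq0| |by rewrite sqrtCK].
  by apply/CrealP; rewrite ger0_real // sqrtC_ge0 psd_ge0.
set u := s^-1 *: z.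
have ue i : Q u (e i) = 0 by rewrite psdZl ze mulr0.
have eu i : Q (e i) u = 0 by rewrite QC ue rmorph0.
have uu : Q u u = 1.
  by rewrite psdZl psdZr fmorphV /= sr -ss; field.
have xu : Q x u = s.
  have -> : x = z + orthoproj e x by rewrite subrK.
  rewrite psdDl [X in _ + X]psd_suml big1 ?addr0; last first.
    by move=> i _; rewrite psdZl eu mulr0.
  by rewrite psdZr fmorphV /= sr -ss expr2 mulKf.
exists (fun i => oapp e u (unlift ord_max i)); split.
- move=> i j; case: unliftP => [i' ->|->]; case: unliftP => [j' ->|->] /=.
  + by rewrite oe (inj_eq lift_inj).
  + by rewrite eu eq_sym (negbTE (neq_lift _ _)).
  + by rewrite ue (negbTE (neq_lift _ _)).
  + by rewrite uu eqxx.
- by move=> i; rewrite liftK.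
- rewrite /orthoproj big_ord_recr /= unlift_none /= xu.
  have -> : \sum_(i < d) Q x (oapp e u (unlift ord_max (widen_ord (leqnSn d) i))) *:
    oapp e u (unlift ord_max (widen_ord (leqnSn d) i)) = orthoproj e x.
    apply: eq_bigr => i _.
    have -> : widen_ord (leqnSn d) i = lift ord_max i.
      by apply/val_inj; rewrite /= /bump leqNgt ltn_ord.
    by rewrite liftK.
  by rewrite /u scalerA divff // scale1r opprD addrA -/z subrr.
Qed.

(** For degenerate Q, a vector whose residual is null adds no basis vector, so the list is captured
    by the span of e only up to null vectors. *)
Lemma gram_schmidt (s : seq V) : exists (d : nat) (e : 'I_d -> V),
  orthonormal_family e /\
  {in s, forall x, Q (x - orthoproj e x) (x - orthoproj e x) = 0}.
Proof.
elim: s => [|x s [d [e [oe es]]]].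
  by exists 0%N, (fun=> 0); split=> // -[].
have [z0|z0] := eqVneq (Q (x - orthoproj e x) (x - orthoproj e x)) 0.
  by exists d, e; split=> // y; rewrite inE => /orP[/eqP->|/es].
have [e' [oe' ee' ex]] := orthonormal_extend oe z0.
exists d.+1, e'; split=> // y; rewrite inE => /orP[/eqP->|ys].
  by rewrite ex psd0l.
have [y0] : Q (y - orthoproj e y) (y - orthoproj e y) = 0 by exact: es.
(* Enlarging e keeps the old residual r of y: the new projection fixes the old one and sends the
   null vector r to 0. *)
have -> // : y - orthoproj e' y = (y - orthoproj e y) - orthoproj e' (y - orthoproj e y).
  rewrite -addrA; congr (_ + _).
  have lin : orthoproj e' (y - orthoproj e y) = orthoproj e' y - orthoproj e' (orthoproj e y).
    by rewrite /orthoproj -sumrB; apply: eq_bigr => i _; rewrite psdBl scalerBl.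
  rewrite lin; have -> : orthoproj e' (orthoproj e y) = orthoproj e y.
    rewrite /orthoproj.
    under eq_bigr => i _.
      rewrite psd_suml scaler_suml; over.
    rewrite exchange_big /=; apply: eq_bigr => j _.
    rewrite (bigD1 (lift ord_max j)) //= -ee' psdZl oe' eqxx mulr1 big1 ?addr0 //.
    by move=> i ij; rewrite psdZl oe' eq_sym (negbTE ij) mulr0 scale0r.
  by rewrite opprB addrA addNr add0r.
have e'0 : orthoproj e' (y - orthoproj e y) = 0.
  by apply: big1 => i _; rewrite QC (psd_null _ y0) rmorph0 scale0r.
by rewrite e'0 subr0.
Qed.

End PositiveForm.

(** * Hilbert spaces, Riesz representation and adjoints *)

Section HilbertNorm.
Context (R : realType).

Definition hnorm (V : normedModType R[i]) (x : V) : R := Re `|x|.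

Section Normed.
Context (V : normedModType R[i]).
Implicit Types x y : V.

Lemma hnormE x : `|x| = (hnorm x)%:C%C.
Proof. by rewrite ge0_ReK. Qed.

Lemma hnorm_ge0 x : 0 <= hnorm x.
Proof. exact: Re_ge0. Qed.

Lemma hnorm0 : hnorm (0 : V) = 0.
Proof. by rewrite /hnorm normr0. Qed.

Lemma hnorm0_eq0 x : hnorm x = 0 -> x = 0.
Proof. by move=> h; apply/normr0_eq0; rewrite hnormE h. Qed.

Lemma ler_hnormD x y : hnorm (x + y) <= hnorm x + hnorm y.
Proof. by have := ler_normD x y; rewrite !hnormE -rmorphD /= lecR. Qed.

Lemma hnormN x : hnorm (- x) = hnorm x.
Proof. by rewrite /hnorm normrN. Qed.

Lemma hnormBC x y : hnorm (x - y) = hnorm (y - x).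
Proof. by rewrite /hnorm distrC. Qed.

Lemma ler_hdistD z x y : hnorm (x - y) <= hnorm (x - z) + hnorm (z - y).
Proof. by rewrite -{1}(subrK z x) -addrA ler_hnormD. Qed.

Lemma hnormZ a x : hnorm (a *: x) = Re `|a| * hnorm x.
Proof. by rewrite /hnorm normrZ -{1}(ge0_ReK (normr_ge0 a)) ReMl. Qed.

Lemma hnormZr (a : R) x : 0 <= a -> hnorm (a%:C%C *: x) = a * hnorm x.
Proof. by move=> a0; rewrite hnormZ ger0_norm ?ler0c. Qed.

End Normed.

Lemma ler_harmonic_eps (x y M : R) :
  (forall k : nat, x <= y + M / k.+1%:R) -> x <= y.
Proof.
move=> h; apply/ler_addgt0Pr => e e0.
have [M0|M0] := leP M 0.
  apply: le_trans (h 0%N) _; rewrite divr1; lra.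
have eM : 0 < e / M by rewrite divr_gt0.
have [N _ /(_ N (leqnn N)) /= hN] := near_infty_natSinv_lt (PosNum eM).
apply: le_trans (h N) _; rewrite lerD2l mulrC -ler_pdivlMr //; exact: ltW.
Qed.

(** Letting l grow leaves the explicit rate M/(k+1) for the limit, so that the uses of completeness
    below need inequalities only. *)
Lemma harmonic_cauchy_cvg (V : completeNormedModType R[i]) (u : nat -> V) (M : R) :
  (forall k l, hnorm (u k - u l) <= M / k.+1%:R + M / l.+1%:R) ->
  exists x, forall k, hnorm (u k - x) <= M / k.+1%:R.
Proof.
(* An opaque name for the rate, which [lra] then treats as an atom. *)
have [h hE] : exists h : nat -> R, forall k, M / k.+1%:R = h k by eexists.
move=> hu'; have hu k l : hnorm (u k - u l) <= h k + h l by rewrite -!hE.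
have M0 : 0 <= M.
  by have := hu 0%N 0%N; rewrite subrr hnorm0 -hE divr1; lra.
have small (e : R) : 0 < e -> exists N, forall k, (N <= k)%N -> h k < e.
  move=> e0; have eM : 0 < e / (M + 1) by rewrite divr_gt0 //; lra.
  have [N _ hN] := near_infty_natSinv_lt (PosNum eM).
  exists N => k /hN /= hk; rewrite -hE; have M1 : 0 < M + 1 by lra.
  apply: (@le_lt_trans _ _ ((M + 1) / k.+1%:R)); first by rewrite ler_pM2r ?invr_gt0 ?ltr0n // lerDl.
  by rewrite mulrC -ltr_pdivlMr.
have /cauchy_cvgP cu : cauchy (u @ \oo)%classic.
  apply/cauchy_ballP => e e0 /=.
  have [r r0 er] : exists2 r : R, 0 < r & e = r%:C%C.
    exists (Re e); last by rewrite ge0_ReK // ltW.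
    by move: e0; rewrite ltcE => /andP[].
  have e2 : 0 < r / 2 by rewrite divr_gt0.
  have [N hN] := small _ e2.
  exists ([set u k | k in [set k | (N <= k)%N]], [set u k | k in [set k | (N <= k)%N]])%classic => /=.
    by split; exists N => // k /= Nk; exists k.
  move=> [x y] /= [[k Nk <-] [l Nl <-]]; rewrite -ball_normE /ball_ /= hnormE er ltcR.
  apply: le_lt_trans (hu _ _) _; have := hN _ Nk; have := hN _ Nl; lra.
exists (lim (u @ \oo))%classic => k; rewrite hE.
apply/ler_addgt0Pr => e e0.
have e2 : 0 < e / 2 by lra.
have [N hN] := small _ e2.
have e2c : 0 < (e / 2)%:C%C :> R[i] by rewrite ltcR.
have [N' _ hN'] := @cvgr_dist_lt _ _ _ _ _ _ _ cu _ e2c.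
set l := maxn N N'.
apply: le_trans (ler_hdistD (u l) _ _) _.
have := hN' l (leq_maxr _ _); rewrite /= hnormE ltcR => h1.
have := hN l (leq_maxl _ _) => h2.
rewrite [hnorm (u l - _)]hnormBC; have := hu k l; lra.
Qed.

End HilbertNorm.

Lemma inner_psd (R : realType) (V : innerProductType R) : psd_form (@inner R V).
Proof.
split=> [a x y z|x y|x]; rewrite /inner.
- by rewrite linearPl.
- by rewrite hermC expr0 mul1r.
- exact: dnorm_ge0.
Qed.

Section InnerProduct.
Context (R : realType) (V : innerProductType R).
Implicit Types x y z : V.

Lemma innerDl x y z : inner (x + y) z = inner x z + inner y z.
Proof. exact/psdDl/inner_psd. Qed.

Lemma innerBl x y z : inner (x - y) z = inner x z - inner y z.
Proof. exact/psdBl/inner_psd. Qed.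

Lemma innerBr x y z : inner z (x - y) = inner z x - inner z y.
Proof. exact/psdBr/inner_psd. Qed.

Lemma innerZl a x z : inner (a *: x) z = a * inner x z.
Proof. exact/psdZl/inner_psd. Qed.

Lemma innerZr a x z : inner z (a *: x) = Num.conj a * inner z x.
Proof. exact/psdZr/inner_psd. Qed.

Lemma innerC x y : inner y x = Num.conj (inner x y).
Proof. exact/psdC/inner_psd. Qed.

Lemma inner_suml (I : Type) (s : seq I) (P : pred I) (F : I -> V) z :
  inner (\sum_(i <- s | P i) F i) z = \sum_(i <- s | P i) inner (F i) z.
Proof. exact/psd_suml/inner_psd. Qed.

Lemma inner_sumr (I : Type) (s : seq I) (P : pred I) (F : I -> V) z :
  inner z (\sum_(i <- s | P i) F i) = \sum_(i <- s | P i) inner z (F i).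
Proof. exact/psd_sumr/inner_psd. Qed.

Lemma inner_eq0 x : inner x x = 0 -> x = 0.
Proof. by move=> h; apply/eqP; rewrite -(dnorm_eq0 inner_form); apply/eqP. Qed.

Lemma inner_injr x y : (forall z, inner z x = inner z y) -> x = y.
Proof.
move=> h; apply/subr0_eq/inner_eq0.
by rewrite innerBr h subrr.
Qed.

Lemma Re_inner_cauchy x y : Re (inner x y) ^+ 2 <= Re (inner x x) * Re (inner y y).
Proof. exact/psd_Re_cauchy/inner_psd. Qed.

End InnerProduct.

Section Riesz.
Context (R : realType) (V : hilbertType R).
Implicit Types x y z : V.

Lemma inner_hnorm x : inner x x = (hnorm x ^+ 2)%:C%C.
Proof. by rewrite -normr_inner hnormE rmorphXn. Qed.

Lemma hnorm_sqr x : hnorm x ^+ 2 = Re (inner x x).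
Proof. by rewrite inner_hnorm. Qed.

Lemma Re_inner_le x y : Re (inner x y) <= hnorm x * hnorm y.
Proof.
apply: le_trans (ler_norm _) _.
rewrite -(@ler_pXn2r _ 2) ?nnegrE ?mulr_ge0 ?hnorm_ge0 //.
by rewrite exprMn !hnorm_sqr -normrX ger0_norm ?sqr_ge0 // Re_inner_cauchy.
Qed.

Lemma hnormD_sqr x y :
  hnorm (x + y) ^+ 2 = hnorm x ^+ 2 + 2 * Re (inner x y) + hnorm y ^+ 2.
Proof. by rewrite !hnorm_sqr (psd_pythag (inner_psd V)). Qed.

(* The representing vector minimises |x|^2 - 2 Re (phi x); minimising sequences are Cauchy by the parallelogram law. *)
Lemma riesz (phi : V -> R[i]) (M : R) :
  (forall a x y, phi (a *: x + y) = a * phi x + phi y) ->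
  (forall x, Re (phi x) <= M * hnorm x) ->
  exists z, forall x, phi x = inner x z.
Proof.
move=> phil phib.
have phiD x y : phi (x + y) = phi x + phi y by rewrite -[x in LHS]scale1r phil mul1r.
have phi0 : phi 0 = 0 by apply: (addIr (phi 0)); rewrite -phiD !add0r.
have phiZ a x : phi (a *: x) = a * phi x by rewrite -[_ *: _]addr0 phil phi0 addr0.
pose J x := hnorm x ^+ 2 - 2 * Re (phi x).
have JD x y : J (x + y) = J x + hnorm y ^+ 2 + 2 * Re (inner y x - phi y).
  by rewrite /J hnormD_sqr phiD ReB ReD [inner y x]innerC Re_conj; ring.
have Jlb x : - M ^+ 2 <= J x.
  rewrite /J; have := phib x; have := sqr_ge0 (hnorm x - M); nra.
have infJ : has_inf (range J).
  by split; [exists (J 0), 0|exists (- M ^+ 2) => _ [x _ <-]].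
pose d := inf (range J).
have dJ x : d <= J x by apply: ge_inf; [case: infJ|exists x].
(* With a = 1/(k+1) and b = 1/(l+1), comparing J at [u k], [u l] and their midpoint gives |u_k -
   u_l|^2 <= (a^2 + b^2)/2 <= (a + b)^2. *)
have /choice [u hu] : forall k : nat, exists x, J x < d + (k.+1%:R)^-1 ^+ 2 / 4.
  move=> k.
  have e0 : 0 < (k.+1%:R : R)^-1 ^+ 2 / 4 by rewrite divr_gt0 // exprn_gt0 // invr_gt0.
  by have [_ [x _ <-]] := inf_adherent e0 infJ; exists x.
have [z hz] : exists z, forall k, hnorm (u k - z) <= 1 / k.+1%:R.
  apply: harmonic_cauchy_cvg => k l; rewrite !mul1r.
  have a0 : 0 < (k.+1%:R : R)^-1 by rewrite invr_gt0.
  have b0 : 0 < (l.+1%:R : R)^-1 by rewrite invr_gt0.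
  move: (hu k) (hu l) a0 b0; set a := k.+1%:R^-1; set b := l.+1%:R^-1 => ha hb a0 b0.
  rewrite -(@ler_pXn2r _ 2) ?nnegrE ?addr_ge0 ?hnorm_ge0 ?(ltW a0) ?(ltW b0) //.
  pose y := 2^-1 *: (u l - u k).
  have half2 : (2^-1 : R[i]) = (2^-1 : R)%:C%C by rewrite fmorphV rmorph_nat.
  have yn : hnorm y ^+ 2 = hnorm (u k - u l) ^+ 2 / 4.
    by rewrite /y half2 hnormZr ?invr_ge0 // hnormBC; field.
  have mid : u k + y = u l - y.
    apply/(addIr y); rewrite subrK -addrA /y -scalerDl.
    have -> : 2^-1 + 2^-1 = 1 :> R[i] by field.
    by rewrite scale1r addrC subrK.
  have J1 := JD (u k + y) (- y); have J2 := JD (u k + y) y.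
  rewrite addrK in J1; rewrite {1}mid subrK in J2.
  have phiN : phi (- y) = - phi y by rewrite -scaleN1r phiZ mulN1r.
  have inN w : inner (- y) w = - inner y w by rewrite -scaleN1r innerZl mulN1r.
  rewrite inN phiN hnormN ReB !ReN in J1; rewrite ReB in J2.
  by have := dJ (u k + y); rewrite yn in J1 J2; nra.
exists z => x; apply/eqP; rewrite -subr_eq0; apply/eqP.
have pos y : 0 <= hnorm y ^+ 2 + 2 * Re (inner y z - phi y).
  (* Minimality of z is tested through [u k], which avoids continuity of J: the excess of J at [u k]
     costs at most 1/(k+1), and replacing [u k] by z in the inner product costs 2 |y|/(k+1). *)
  apply: (@ler_harmonic_eps _ _ _ (1 + 2 * hnorm y)) => k.
  have := dJ (u k + y); rewrite JD; have := hu k; have := hz k.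
  have -> : inner y (u k) = inner y z + inner y (u k - z) by rewrite innerBr addrC subrK.
  have := Re_inner_le y (u k - z); rewrite !ReB !ReD.
  have a0 : 0 < (k.+1%:R : R)^-1 by rewrite invr_gt0.
  have a1 : (k.+1%:R : R)^-1 <= 1 by rewrite invf_le1 // ler1n.
  rewrite mul1r; move: a0 a1; set a := k.+1%:R^-1 => a0 a1.
  have := hnorm_ge0 y; have := hnorm_ge0 (u k - z); nra.
set t := phi x - inner x z.
have [N N0 tN] := mul_conj_ge0 t.
have [Npos|N_le0] := ltP 0 N; last first.
  have N_eq0 : N = 0 by apply/le_anti; rewrite N_le0 N0.
  by move: tN; rewrite N_eq0 -normCK => /eqP; rewrite expf_eq0 /= normr_eq0 => /eqP.
(* For y = s conj(t) x the inequality [pos] reads s N (s |x|^2 - 2) >= 0, and s |x|^2 = 1 - s makes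
   the bracket negative. *)
pose s : R := (hnorm x ^+ 2 + 1)^-1.
have X0 : 0 < hnorm x ^+ 2 + 1 by have := sqr_ge0 (hnorm x); lra.
have s0 : 0 < s by rewrite invr_gt0.
have := pos ((s%:C%C * Num.conj t) *: x).
rewrite innerZl phiZ -mulrBr -[inner x z - phi x]opprB -/t mulrN -mulrA.
rewrite [Num.conj t * t]mulrC tN ReN ReMl (ReC N).
have -> : hnorm ((s%:C%C * Num.conj t) *: x) ^+ 2 = s ^+ 2 * N * hnorm x ^+ 2.
  by rewrite -scalerA hnormZr ?(ltW s0) // exprMn !hnorm_sqr innerZl innerZr conjCK mulrA
    [Num.conj t * t]mulrC tN ReMl mulrA.
have sX : s * (hnorm x ^+ 2 + 1) = 1 by rewrite mulVf // gt_eqF.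
have -> : s ^+ 2 * N * hnorm x ^+ 2 + 2 * - (s * N) = s * N * (s * (hnorm x ^+ 2 + 1) - s - 2) by ring.
by rewrite sX pmulr_rge0 ?mulr_gt0 // leNgt; have -> : 1 - s - 2 < 0 by lra.
Qed.

End Riesz.

Section Adjoint.
Context (R : realType).

Lemma bounded_op (V W : normedModType R[i]) (f : {bounded_linear V -> W}) :
  exists2 M : R, 0 <= M & forall x, hnorm (f x) <= M * hnorm x.
Proof.
have /linear_boundedP [M [Mr hM]] : bounded_near f (nbhs (0 : V)).
  by apply/linear_bounded_continuous; exact: cts_fun.
have [m m0 mM] : exists2 m : R, 0 <= m & `|M| = m%:C%C.
  by exists (Re `|M|); rewrite ?Re_ge0 // ge0_ReK.
exists (m + 1) => [|x]; first by rewrite addr_ge0.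
have lt_M : M < (m + 1)%:C%C.
  by apply: le_lt_trans (real_ler_norm Mr) _; rewrite mM ltcR ltrDl.
by have := hM _ lt_M x; rewrite !hnormE -rmorphM lecR.
Qed.

(** [adjoint] returns a default value when no adjoint exists, so its defining identity is available
    only under this predicate. *)
Definition has_adjoint (V W : innerProductType R) (T : V -> W) : Prop :=
  exists S : W -> V, forall x y, inner (T x) y = inner x (S y).

Lemma adjointP (V W : innerProductType R) (T : V -> W) : has_adjoint T ->
  forall x y, inner (T x) y = inner x (adjoint T y).
Proof. by move=> hT; exact: (xgetPex _ hT). Qed.

Lemma adjoint_eq (V W : innerProductType R) (T : V -> W) (S : W -> V) :
  (forall x y, inner (T x) y = inner x (S y)) -> adjoint T = S.
Proof.
move=> TS; apply/funext => y; apply: inner_injr => x.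
by rewrite -TS adjointP //; exists S.
Qed.

Lemma bounded_has_adjoint (V W : hilbertType R) (T : {bounded_linear V -> W}) :
  has_adjoint T.
Proof.
have [M M0 hM] := bounded_op T.
suff : forall y, exists z, forall x, inner (T x) y = inner x z.
  by move=> /choice [S hS]; exists S => x y; exact: hS.
move=> y; apply: (@riesz _ _ (fun x => inner (T x) y) (M * hnorm y)) => [a x x'|x].
  by rewrite linearP innerDl innerZl.
apply: le_trans (Re_inner_le _ _) _; rewrite mulrAC ler_wpM2r ?hnorm_ge0 //.
Qed.

Lemma inner_op_Re (V : innerProductType R) (T : V -> V) x : has_adjoint T ->
  inner (op_Re T x) x = (Re (inner (T x) x))%:C%C.
Proof.
move=> hT; rewrite /op_Re innerZl innerDl [inner (adjoint T x) x]innerC -adjointP //.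
have -> : (2^-1 : R[i]) = (2^-1 : R)%:C%C by rewrite fmorphV rmorph_nat.
by rewrite addr_conj -rmorphM mulKf ?pnatr_eq0.
Qed.

End Adjoint.

(** * Row contractions and row isometries *)

Section OperatorNorm.
Context (R : realType).

Lemma op_norm_ge (V W : normedModType R[i]) (T : {bounded_linear V -> W}) x :
  hnorm (T x) <= op_norm T * hnorm x.
Proof.
have [x0|x0] := eqVneq (hnorm x) 0.
  by rewrite (hnorm0_eq0 x0) linear0 !hnorm0 mulr0.
have xpos : 0 < hnorm x by rewrite lt_def x0 hnorm_ge0.
have [M M0 hM] := bounded_op T.
rewrite -ler_pdivrMr // mulrC -hnormZr ?invr_ge0 ?hnorm_ge0 // -linearZ.
apply: ub_le_sup.
  exists M => _ [y /= y1 <-]; apply: le_trans (hM y) _.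
  by rewrite -[leRHS]mulr1 ler_wpM2l //; move: y1; rewrite hnormE lecR.
exists (((hnorm x)^-1)%:C%C *: x) => //=.
by rewrite hnormE hnormZr ?invr_ge0 ?hnorm_ge0 // mulVf.
Qed.

Lemma op_norm_le (V W : normedModType R[i]) (T : V -> W) (c : R) : 0 <= c ->
  (forall x, hnorm (T x) <= c * hnorm x) -> op_norm T <= c.
Proof.
move=> c0 hT; apply: ge_sup.
  by exists (Re `|T 0|), 0 => //=; rewrite normr0 ler01.
move=> _ [x /= x1 <-]; apply: le_trans (hT x) _.
by rewrite -[leRHS]mulr1 ler_wpM2l //; move: x1; rewrite hnormE lecR.
Qed.

End OperatorNorm.

Lemma ffun_innerE (R : realType) (I : finType) (V : innerProductType R)
  (f g : {ffun I -> V}) : inner f g = \sum_i inner (f i) (g i).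
Proof. by []. Qed.

Section RowContraction.
Context (R : realType) (n : nat) (K : hilbertType R).

Lemma sum_inner_cauchy (I : finType) (p q : I -> K) :
  Re (\sum_i inner (p i) (q i)) ^+ 2 <=
  (\sum_i hnorm (p i) ^+ 2) * (\sum_i hnorm (q i) ^+ 2).
Proof.
have := Re_inner_cauchy (finfun p) (finfun q).
rewrite !ffun_innerE (eq_bigr (fun i => inner (p i) (q i))); last by move=> i _; rewrite !ffunE.
rewrite !Re_sum => /le_trans; apply; rewrite le_eqVlt; apply/orP; left; apply/eqP.
by congr (_ * _); apply: eq_bigr => i _; rewrite ffunE hnorm_sqr.
Qed.

Lemma row_sqE (X : 'I_n -> K -> K) y : row_sq X y = \sum_i X i (adjoint (X i) y).
Proof. by rewrite /row_sq fct_sumE. Qed.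

Lemma inner_row_sq (X : 'I_n -> {bounded_linear K -> K}) y z :
  inner (row_sq X y) z = \sum_i inner (adjoint (X i) y) (adjoint (X i) z).
Proof.
rewrite row_sqE inner_suml; apply: eq_bigr => i _.
by rewrite adjointP //; exact: bounded_has_adjoint.
Qed.

(** With z = [row_sq X y], |z|^2 is the sum of the inner products of X_i^* y and X_i^* z, so
    Cauchy-Schwarz in the direct sum gives |z|^4 <= r^2 |y|^2 r^2 |z|^2. Dividing by |z|^2 bounds
    the norm of [row_sq X] by r^2. *)
Lemma row_norm_le (X : 'I_n -> {bounded_linear K -> K}) (r : R) : 0 <= r ->
  (forall y, \sum_i hnorm (adjoint (X i) y) ^+ 2 <= r ^+ 2 * hnorm y ^+ 2) ->
  row_norm X <= r.
Proof.
move=> r0 hX; rewrite /row_norm -[leRHS]ger0_norm // -sqrtr_sqr ler_wsqrtr //.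
apply: op_norm_le => [|y]; first exact: sqr_ge0.
have [->|z0] := eqVneq (hnorm (row_sq X y)) 0.
  by rewrite mulr_ge0 ?sqr_ge0 ?hnorm_ge0.
have zpos : 0 < hnorm (row_sq X y) by rewrite lt_def z0 hnorm_ge0.
have := sum_inner_cauchy (fun i => adjoint (X i) y) (fun i => adjoint (X i) (row_sq X y)).
rewrite -inner_row_sq -hnorm_sqr => h.
have : (hnorm (row_sq X y) ^+ 2) ^+ 2 <= (r ^+ 2 * hnorm y ^+ 2) * (r ^+ 2 * hnorm (row_sq X y) ^+ 2).
  apply: le_trans h _; apply: ler_pM; rewrite ?hX ?sumr_ge0 // => i _; exact: sqr_ge0.
move=> {}h; rewrite -(@ler_pXn2r _ 2) ?nnegrE ?mulr_ge0 ?sqr_ge0 ?hnorm_ge0 //.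
rewrite -(@ler_pM2r _ (hnorm (row_sq X y) ^+ 2)) ?exprn_gt0 // -expr2.
by apply: le_trans h _; rewrite le_eqVlt; apply/orP; left; apply/eqP; ring.
Qed.

(** The column of the adjoints X_i^* is contractive, because the squares |X_i^* y|^2 add up to the
    quadratic form of [row_sq X]; the row is its adjoint, and Cauchy-Schwarz transfers the bound. *)
Lemma row_contraction (X : 'I_n -> {bounded_linear K -> K}) : row_norm X <= 1 ->
  forall u : 'I_n -> K, hnorm (\sum_i X i (u i)) ^+ 2 <= \sum_i hnorm (u i) ^+ 2.
Proof.
move=> X1.
have adj i : has_adjoint (X i) by exact: bounded_has_adjoint.
(* [row_sq X] is a bare function, so the supremum in [op_norm] must be shown to range over a bounded
   set before it bounds anything. *)
have sq_bounded : exists2 M : R, 0 <= M & forall y, hnorm (row_sq X y) <= M * hnorm y.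
  have /choice [M hM] : forall i, exists M : R, 0 <= M /\ forall x, hnorm (X i x) <= M * hnorm x.
    by move=> i; have [M ? ?] := bounded_op (X i); exists M.
  have hA i y : hnorm (adjoint (X i) y) <= M i * hnorm y.
    have [M0 Mb] := hM i; set z := adjoint (X i) y.
    have [->|z0] := eqVneq (hnorm z) 0; first by rewrite mulr_ge0 ?hnorm_ge0.
    have zpos : 0 < hnorm z by rewrite lt_def z0 hnorm_ge0.
    rewrite -(ler_pM2r zpos) -expr2 hnorm_sqr -adjointP //.
    by apply: le_trans (Re_inner_le _ _) _; have := Mb z; have := hnorm_ge0 y; nra.
  exists (\sum_i M i * M i) => [|y].
    by apply: sumr_ge0 => i _; rewrite mulr_ge0 // (proj1 (hM i)).
  rewrite row_sqE mulr_suml; elim/big_ind2: _ => [|a b c d h1 h2|i _].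
  - by rewrite hnorm0.
  - by apply: le_trans (ler_hnormD _ _) _; exact: lerD.
  - have [M0 Mb] := hM i; apply: le_trans (Mb _) _.
    by rewrite -mulrA ler_wpM2l // hA.
have sq1 : op_norm (row_sq X) <= 1.
  have [s0|s0] := leP (op_norm (row_sq X)) 0; first exact: le_trans s0 ler01.
  move: X1; rewrite /row_norm -[leRHS]sqrtr1 ler_sqrt //.
have sq_contr y : hnorm (row_sq X y) <= hnorm y.
  have [M M0 hM] := sq_bounded.
  have [y0|y0] := eqVneq (hnorm y) 0.
    by have := hM y; rewrite y0 mulr0.
  have ypos : 0 < hnorm y by rewrite lt_def y0 hnorm_ge0.
  rewrite -[leRHS]mul1r -ler_pdivrMr // mulrC -hnormZr ?invr_ge0 ?hnorm_ge0 //.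
  apply: le_trans sq1; apply: ub_le_sup.
    exists M => _ [z /= z1 <-]; apply: le_trans (hM z) _.
    by rewrite -[leRHS]mulr1 ler_wpM2l //; move: z1; rewrite hnormE lecR.
  exists (((hnorm y)^-1)%:C%C *: y) => /=.
    by rewrite hnormE hnormZr ?invr_ge0 ?hnorm_ge0 // mulVf.
  congr (Re `| _ |); rewrite !row_sqE scaler_sumr; apply: eq_bigr => i _.
  rewrite -linearZ; congr (X i _); apply: inner_injr => x.
  by rewrite innerZr -!adjointP // innerZr.
have adj_contr y : \sum_i hnorm (adjoint (X i) y) ^+ 2 <= hnorm y ^+ 2.
  have -> : \sum_i hnorm (adjoint (X i) y) ^+ 2 = Re (inner (row_sq X y) y).
    by rewrite inner_row_sq Re_sum; apply: eq_bigr => i _; rewrite hnorm_sqr.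
  by apply: le_trans (Re_inner_le _ _) _; rewrite expr2 ler_wpM2r ?hnorm_ge0.
move=> u; set y := \sum_i X i (u i).
have E : hnorm y ^+ 2 = Re (\sum_i inner (u i) (adjoint (X i) y)).
  rewrite hnorm_sqr {1}/y inner_suml; congr (Re _); apply: eq_bigr => i _.
  by rewrite adjointP.
have h := sum_inner_cauchy u (fun i => adjoint (X i) y).
rewrite -E in h.
have [->|y0] := eqVneq (hnorm y) 0.
  by rewrite expr0n sumr_ge0 // => i _; exact: sqr_ge0.
have ypos : 0 < hnorm y ^+ 2 by rewrite exprn_gt0 // lt_def y0 hnorm_ge0.
rewrite -(ler_pM2r ypos) -expr2; apply: le_trans h _.
by rewrite ler_wpM2l ?adj_contr // sumr_ge0 // => i _; exact: sqr_ge0.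
Qed.

End RowContraction.

Section Isometries.
Context (R : realType).

(** Polarisation: norms determine the real parts, and the real part at i x is minus the imaginary
    part at x. *)
Lemma isometry_inner (V W : hilbertType R) (T : {linear V -> W}) :
  (forall x, `|T x| = `|x|) -> forall x y, inner (T x) (T y) = inner x y.
Proof.
move=> isoT.
have hT x : hnorm (T x) = hnorm x by rewrite /hnorm isoT.
have ReT x y : Re (inner (T x) (T y)) = Re (inner x y).
  have := hnormD_sqr (T x) (T y); have := hnormD_sqr x y.
  by rewrite -linearD !hT => ->; lra.
move=> x y; have := ReT ('i%C *: x) y; have := ReT x y.
rewrite linearZ !innerZl; case: (inner (T x) (T y)) (inner x y) => a b [c d] /= ->.
by rewrite !mul0r !sub0r !mul1r => /oppr_inj ->.
Qed.

(** At the vector V_j y the j-th term of the row square already exhausts |V_j y|^2, so the condition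
    V_1 V_1^* + ... + V_n V_n^* <= I forces V_i^* V_j y = 0 for i different from j. *)
Lemma row_isometry_inner (n : nat) (K : hilbertType R) (V : 'I_n -> {bounded_linear K -> K}) :
  (forall i x, `|V i x| = `|x|) -> op_le (row_sq V) idfun ->
  forall i j x y, inner (V i x) (V j y) = (i == j)%:R * inner x y.
Proof.
move=> isoV leV i j x y.
have [<-|ij] := eqVneq i j; first by rewrite mul1r (isometry_inner (isoV i)).
have adj k : has_adjoint (V k) by exact: bounded_has_adjoint.
suff V0 : adjoint (V i) (V j y) = 0 by rewrite adjointP // V0 (psd0r (inner_psd K)) mul0r.
have Vj : adjoint (V j) (V j y) = y.
  by apply: inner_injr => z; rewrite -adjointP // (isometry_inner (isoV j)).
have := Re_ge0 (leV (V j y)).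
have -> : (idfun - row_sq V) (V j y) = V j y - row_sq V (V j y) by [].
rewrite innerBl (isometry_inner (isoV j)) inner_row_sq ReB Re_sum (bigD1 j) //= Vj.
rewrite (bigD1 i) //= opprD addrA subrr add0r oppr_ge0 -hnorm_sqr => h.
apply/hnorm0_eq0/eqP; rewrite -sqrf_eq0; apply/eqP/le_anti; rewrite sqr_ge0 andbT.
apply: le_trans h; rewrite lerDl; apply: sumr_ge0 => k _.
by rewrite -hnorm_sqr sqr_ge0.
Qed.

End Isometries.

(** * Words of bounded length *)

Section Words.
Context (n : nat).
Implicit Types (w a b : seq 'I_n).

Fixpoint words (k : nat) : seq (seq 'I_n) :=
  [::] :: if k is k'.+1 then flatten [seq [seq i :: w | w <- words k'] | i <- enum 'I_n]
          else [::].

Lemma mem_words k w : (w \in words k) = (size w <= k)%N.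
Proof.
elim: k w => [|k IH] [|i w] //=; rewrite inE /= ltnS -IH.
apply/flattenP/idP => [[_ /mapP [j _ ->]] /mapP [w' w'k [_ ->]] //|wk].
by exists [seq i :: w | w <- words k]; [apply: map_f; rewrite mem_enum|apply: map_f].
Qed.

Lemma words_uniq k : uniq (words k).
Proof.
elim: k => [|k IH] //=; apply/andP; split.
  by apply/negP => /flattenP [_ /mapP [j _ ->]] /mapP [].
rewrite -[flatten _]/[seq i :: w | i <- enum 'I_n, w <- words k].
by rewrite allpairs_uniq ?enum_uniq // => -[i w] [j w'] _ _ /= [-> ->].
Qed.

(** Splitting off the first letter is the recursion behind the inductions on k below. *)
Lemma big_words (M : nmodType) k (F : seq 'I_n -> M) :
  \sum_(w <- words k.+1) F w = F [::] + \sum_i \sum_(w <- words k) F (i :: w).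
Proof.
rewrite big_cons /= big_flatten /= big_map big_enum /=; congr (_ + _).
by apply: eq_bigr => i _; rewrite big_map.
Qed.

Lemma big_words_widen (M : nmodType) k l (F : seq 'I_n -> M) : (k <= l)%N ->
  (forall w, (k < size w)%N -> F w = 0) ->
  \sum_(w <- words l) F w = \sum_(w <- words k) F w.
Proof.
elim: k l F => [|k IH] [|l] F // kl F0; rewrite !big_words.
  rewrite [RHS]big_cons big_nil addr0 big1 ?addr0 // => i _.
  by apply: big1 => w _; rewrite F0.
by congr (_ + _); apply: eq_bigr => i _; apply: IH => // w kw; rewrite F0.
Qed.

End Words.

(** * Multi-Toeplitz kernels *)

Section WordOperators.
Context (R : realType) (n : nat).

Lemma word_op_linear (V : lmodType R[i]) (X : 'I_n -> {linear V -> V}) w a x y :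
  word_op X w (a *: x + y) = a *: word_op X w x + word_op X w y.
Proof. by elim: w => [|i w IH] //=; rewrite IH linearP. Qed.

Definition word_sum (V : lmodType R[i]) (X : 'I_n -> V -> V) k (h : seq 'I_n -> V) : V :=
  \sum_(w <- words n k) word_op X w (h w).

Lemma word_sum0 (V : lmodType R[i]) (X : 'I_n -> V -> V) h : word_sum X 0 h = h [::].
Proof. by rewrite /word_sum big_seq1. Qed.

Lemma word_sumS (V : lmodType R[i]) (X : 'I_n -> {linear V -> V}) k h :
  word_sum X k.+1 h = h [::] + \sum_i X i (word_sum X k (fun w => h (i :: w))).
Proof.
rewrite /word_sum big_words; congr (_ + _); apply: eq_bigr => i _.
by rewrite linear_sum.
Qed.

(* The entries of the multi-Toeplitz kernel, with the lower half folded onto the upper one by doubling. *)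
Fixpoint toeplitz (V : lmodType R[i]) (X : 'I_n -> V -> V) (b a : seq 'I_n) (h : V) : V :=
  match b, a with
  | [::], [::] => h
  | [::], _ => 2 *: word_op X a h
  | i :: b', j :: a' => if i == j then toeplitz X b' a' h else 0
  | _ :: _, [::] => 0
  end.

(** Taking real parts turns 2 X_w at the entry (b, a) into X_w there and X_w^* at (a, b), whence the
    2 off the diagonal. *)
Definition toeplitz_coef (b a w : seq 'I_n) : R[i] :=
  if a == b ++ w then if w is [::] then 1 else 2 else 0.

(** At most one w satisfies a = b w, and it is no longer than a; the sum therefore has at most one
    nonzero term. *)
Lemma toeplitzE (V : lmodType R[i]) (X : 'I_n -> V -> V) k b a h : (size a <= k)%N ->
  toeplitz X b a h = \sum_(w <- words n k) toeplitz_coef b a w *: word_op X w h.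
Proof.
elim: b a => [|i b IH] [|j a] sa.
- rewrite (bigD1_seq [::]) ?words_uniq ?mem_words //= scale1r big1 ?addr0 //.
  by case=> //= i w _; rewrite scale0r.
- rewrite (bigD1_seq (j :: a)) ?words_uniq ?mem_words //= /toeplitz_coef eqxx.
  rewrite big1 ?addr0 // => w wa.
  by rewrite eq_sym (negbTE wa) scale0r.
- by rewrite /= big1 // => w _; rewrite scale0r.
- rewrite /=; have [<-|ij] := eqVneq i j; last first.
    by rewrite big1 // => w _; rewrite /toeplitz_coef eqseq_cons eq_sym (negbTE ij) scale0r.
  rewrite IH; last exact: ltnW.
  by apply: eq_bigr => w _; rewrite /toeplitz_coef eqseq_cons eqxx.
Qed.

Definition toeplitz_form (V : innerProductType R) (X : 'I_n -> V -> V) k (h : seq 'I_n -> V) : R[i] :=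
  \sum_(b <- words n k) \sum_(a <- words n k) inner (toeplitz X b a (h a)) (h b).

(** The row of the empty word gives the first two terms and its column is folded away; words with
    different first letters do not interact, and a common first letter cancels. The shape is that of
    |h_0 + S|^2. *)
Lemma toeplitz_formS (V : innerProductType R) (X : 'I_n -> {linear V -> V}) k h :
  toeplitz_form X k.+1 h = inner (h [::]) (h [::])
    + 2 * inner (\sum_i X i (word_sum X k (fun w => h (i :: w)))) (h [::])
    + \sum_i toeplitz_form X k (fun w => h (i :: w)).
Proof.
rewrite /toeplitz_form big_words; congr (_ + _).
  rewrite big_words; congr (_ + _).
  rewrite inner_suml mulr_sumr; apply: eq_bigr => i _.
  rewrite linear_sum inner_suml mulr_sumr; apply: eq_bigr => w _.
  by rewrite innerZl.
apply: eq_bigr => i _; apply: eq_bigr => b _.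
rewrite big_words (psd0l (inner_psd V)) add0r (bigD1 i) //= eqxx [X in _ + X]big1 ?addr0 // => j ji.
by apply: big1 => a _; rewrite eq_sym (negbTE ji) (psd0l (inner_psd V)).
Qed.

(* Strengthened to dominate |sum_w X_w h_w|^2 so that the induction closes. *)
Lemma toeplitz_form_ge (K : hilbertType R) (X : 'I_n -> {bounded_linear K -> K}) k h :
  (forall u : 'I_n -> K, hnorm (\sum_i X i (u i)) ^+ 2 <= \sum_i hnorm (u i) ^+ 2) ->
  hnorm (word_sum X k h) ^+ 2 <= Re (toeplitz_form X k h).
Proof.
move=> contrX; elim: k h => [|k IH] h.
  by rewrite word_sum0 /toeplitz_form !big_seq1 hnorm_sqr.
rewrite (word_sumS X) (toeplitz_formS X) hnormD_sqr !ReD Re_sum -hnorm_sqr.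
set S := \sum_i X i _.
have -> : Re (2 * inner S (h [::])) = 2 * Re (inner (h [::]) S).
  by rewrite -[2 in LHS](rmorph_nat (real_complex R)) ReMl innerC Re_conj.
(* The terms |h_0|^2 and 2 Re <h_0, S> agree on both sides; only |S|^2 has to be estimated, by row
   contractivity and then by induction. *)
rewrite lerD2l; apply: le_trans (contrX _) _.
by apply: ler_sum => i _; exact: IH.
Qed.

(** The leftmost letter moves to the right-hand vector as V_i^*, which acts on the copy of H as
    T_i^*. *)
Lemma inner_word_op_dilation (H K : hilbertType R) (T : 'I_n -> {bounded_linear H -> H})
    (iota : {linear H -> K}) (V : 'I_n -> {bounded_linear K -> K}) :
  minimal_isometric_dilation T iota V ->
  forall w x y, inner (word_op V w (iota x)) (iota y) = inner (word_op T w x) y.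
Proof.
move=> [iso_iota _ _ adjV _] w x; elim: w => [|i w IH] y; first exact: iso_iota.
rewrite /= (adjointP (bounded_has_adjoint (V i))) adjV IH.
by rewrite (adjointP (bounded_has_adjoint (T i))).
Qed.

(** The recursion of the form matches that of the squared norm: the V_i have orthogonal ranges, so
    |S|^2 splits exactly, and the cross term sees only compressions to H. *)
Lemma toeplitz_form_dilation (H K : hilbertType R) (T : 'I_n -> {bounded_linear H -> H})
    (iota : {linear H -> K}) (V : 'I_n -> {bounded_linear K -> K}) k h :
  minimal_isometric_dilation T iota V ->
  Re (toeplitz_form T k h) = hnorm (word_sum V k (iota \o h)) ^+ 2.
Proof.
move=> dil; have [iso_iota isoV leV adjV _] := dil.
have VV := row_isometry_inner isoV leV.
have compr := inner_word_op_dilation dil.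
elim: k h => [|k IH] h.
  by rewrite word_sum0 /toeplitz_form !big_seq1 hnorm_sqr /= iso_iota.
rewrite (word_sumS V) (toeplitz_formS T) hnormD_sqr !ReD Re_sum.
congr (_ + _ + _).
- by rewrite hnorm_sqr iso_iota.
- rewrite -[2 in LHS](rmorph_nat (real_complex R)) ReMl; congr (2 * _).
  rewrite -[RHS]Re_conj -innerC !inner_suml; congr Re; apply: eq_bigr => i _.
  rewrite linear_sum (adjointP (bounded_has_adjoint (V i))).
  rewrite adjV !inner_suml; apply: eq_bigr => w _.
  by rewrite compr (adjointP (bounded_has_adjoint (T i))).
- rewrite hnorm_sqr inner_suml Re_sum; apply: eq_bigr => i _.
  rewrite IH hnorm_sqr [in RHS]inner_sumr [in RHS](bigD1 i) //= VV eqxx mul1r big1 ?addr0 // => j ji.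
  by rewrite VV eq_sym (negbTE ji) mul0r.
Qed.

End WordOperators.

(** * Matrix polynomials and the Toeplitz polynomial *)

Section Polynomials.
Context (R : realType) (n : nat).

(** The direct sum carries only an inner product structure here, so [riesz] does not apply to it and
    the adjoint is written down explicitly. *)
Lemma ncpoly_eval_adjoint (m : nat) (p : ncpoly R n m) (K : hilbertType R)
    (X : 'I_n -> {bounded_linear K -> K}) : has_adjoint (ncpoly_eval p X).
Proof.
have adjw w : has_adjoint (word_op X w).
  elim: w => [|i w [S hS]]; first by exists idfun.
  by exists (S \o adjoint (X i)) => x y /=; rewrite adjointP ?hS //; exact: bounded_has_adjoint.
exists (fun g : {ffun 'I_m -> K} => [ffun j => \sum_(w <- finsupp p) \sum_i
    Num.conj (p w i j) *: adjoint (word_op X w) (g i)]) => f g.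
rewrite !ffun_innerE.
under eq_bigr => i _.
  rewrite ffunE inner_suml; under eq_bigr => w _ do rewrite inner_suml; over.
under [RHS]eq_bigr => i _.
  rewrite ffunE inner_sumr; under eq_bigr => w _ do rewrite inner_sumr; over.
rewrite exchange_big [RHS]exchange_big; apply: eq_bigr => w _.
rewrite exchange_big; apply: eq_bigr => j _; apply: eq_bigr => i _.
by rewrite innerZl innerZr conjCK adjointP.
Qed.

Lemma op_Re_pos (m : nat) (p : ncpoly R n m) (K : hilbertType R)
    (X : 'I_n -> {bounded_linear K -> K}) :
  op_pos (op_Re (ncpoly_eval p X)) <-> forall f, 0 <= Re (inner (ncpoly_eval p X f) f).
Proof.
have E f := inner_op_Re f (ncpoly_eval_adjoint p X).
by split=> h f; have := h f; rewrite E ler0c.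
Qed.

Lemma harnack_le (m : nat) (p : ncpoly R n m) (H : hilbertType R)
    (A B : 'I_n -> {bounded_linear H -> H}) (c : R) :
  op_le (op_Re (ncpoly_eval p A)) (fun f => (c ^+ 2)%:C%C *: op_Re (ncpoly_eval p B) f) <->
  forall f, Re (inner (ncpoly_eval p A f) f) <= c ^+ 2 * Re (inner (ncpoly_eval p B f) f).
Proof.
have E f : inner (((fun f => (c ^+ 2)%:C%C *: op_Re (ncpoly_eval p B) f)
    - op_Re (ncpoly_eval p A)) f) f
    = (c ^+ 2 * Re (inner (ncpoly_eval p B f) f) - Re (inner (ncpoly_eval p A f) f))%:C%C.
  rewrite [X in inner X _](_ : _ = (c ^+ 2)%:C%C *: op_Re (ncpoly_eval p B) f
    - op_Re (ncpoly_eval p A) f) //.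
  rewrite innerBl innerZl !inner_op_Re; try exact: ncpoly_eval_adjoint.
  by rewrite -rmorphM -rmorphB.
by split=> h f; have := h f; rewrite E ler0c subr_ge0.
Qed.

Definition toeplitz_poly k : ncpoly R n (size (words n k)) :=
  [fsfun w in seq_fset tt (words n k) =>
     \matrix_(i, j) toeplitz_coef R (nth [::] (words n k) i) (nth [::] (words n k) j) w].

Lemma toeplitz_polyE k (V : innerProductType R) (X : 'I_n -> V -> V) (f : {ffun _ -> V}) i :
  ncpoly_eval (toeplitz_poly k) X f i =
  \sum_(j < size (words n k)) toeplitz X (nth [::] (words n k) i) (nth [::] (words n k) j) (f j).
Proof.
set p := toeplitz_poly k.
pose G w := \sum_j p w i j *: word_op X w (f j).
have -> : ncpoly_eval p X f i = \sum_(w <- words n k) G w.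
  rewrite ffunE [RHS](bigID (mem (finsupp p))) /= [X in _ = _ + X]big1 ?addr0; last first.
    move=> w wp; rewrite /G fsfun_dflt //; apply: big1 => j _.
    by rewrite mxE scale0r.
  rewrite -[RHS]big_filter [RHS](perm_big (finsupp p)) //.
  apply: uniq_perm; rewrite ?filter_uniq ?words_uniq //.
  move=> w; rewrite mem_filter; case wp: (w \in finsupp p) => //=.
  move: wp; rewrite mem_finsupp /p /toeplitz_poly fsfunE seq_fsetE.
  by case: (w \in words n k) => //; rewrite eqxx.
rewrite exchange_big; apply: eq_bigr => j _.
rewrite (@toeplitzE _ _ _ _ k); last by rewrite -mem_words mem_nth.
rewrite !big_seq; apply: eq_bigr => w wk.
by rewrite /p /toeplitz_poly fsfunE seq_fsetE wk mxE.
Qed.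

Lemma toeplitz_poly_form k (V : innerProductType R) (X : 'I_n -> V -> V) (h : seq 'I_n -> V) :
  let f := [ffun i : 'I_(size (words n k)) => h (nth [::] (words n k) i)] in
  inner (ncpoly_eval (toeplitz_poly k) X f) f = toeplitz_form X k h.
Proof.
rewrite /= ffun_innerE /toeplitz_form (big_nth [::]) big_mkord; apply: eq_bigr => i _.
rewrite toeplitz_polyE inner_suml (big_nth [::]) big_mkord; apply: eq_bigr => j _.
by rewrite !ffunE.
Qed.

Lemma toeplitz_poly_pos k (K : hilbertType R) : ncpoly_Re_pos K (toeplitz_poly k).
Proof.
move=> X X1; apply/op_Re_pos => f.
(* Reads the vector f as a family indexed by words, with 0 for words that are not in the list. *)
pose h w : K := oapp f 0 (insub (index w (words n k))).
have -> : f = [ffun i : 'I_(size (words n k)) => h (nth [::] (words n k) i)].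
  by apply/ffunP => i; rewrite ffunE /h index_uniq ?words_uniq // valK.
rewrite toeplitz_poly_form; apply: le_trans (toeplitz_form_ge _ _ _).
  exact: sqr_ge0.
exact/row_contraction/ltW.
Qed.

Lemma harnack_word_sum (K H : hilbertType R) (A B : 'I_n -> {bounded_linear H -> H})
    (KA : hilbertType R) (iotaA : {linear H -> KA}) (V : 'I_n -> {bounded_linear KA -> KA})
    (KB : hilbertType R) (iotaB : {linear H -> KB}) (W : 'I_n -> {bounded_linear KB -> KB})
    (c : R) :
  minimal_isometric_dilation A iotaA V -> minimal_isometric_dilation B iotaB W ->
  harnack_dominated K c A B -> forall k h,
  hnorm (word_sum V k (iotaA \o h)) ^+ 2 <= c ^+ 2 * hnorm (word_sum W k (iotaB \o h)) ^+ 2.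
Proof.
move=> dilA dilB AB k h.
have /harnack_le := AB _ _ (@toeplitz_poly_pos k K).
move=> /(_ [ffun i : 'I_(size (words n k)) => h (nth [::] (words n k) i)]).
by rewrite !toeplitz_poly_form (toeplitz_form_dilation _ _ dilA) (toeplitz_form_dilation _ _ dilB).
Qed.

End Polynomials.

Lemma bounded_linear_pack (R : realType) (V W : normedModType R[i]) (f : V -> W) (M : R) :
  (forall a x y, f (a *: x + y) = a *: f x + f y) ->
  (forall x, hnorm (f x) <= M * hnorm x) ->
  exists g : {bounded_linear V -> W}, g =1 f.
Proof.
move=> flin fM.
pose fl : {linear V -> W} := HB.pack f (GRing.isLinear.Build R[i] V W *:%R f flin).
have fc : continuous fl.
  apply/linear_bounded_continuous/linear_boundedP; exists M%:C%C; split.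
    by apply/complex_realP; exists M.
  move=> r Mr x; apply: le_trans (_ : M%:C%C * `|x| <= _).
    by rewrite !hnormE -rmorphM lecR fM.
  by rewrite ler_wpM2r // ltW.
pose g : {bounded_linear V -> W} := HB.pack f (GRing.isLinear.Build R[i] V W *:%R f flin)
  (isContinuous.Build V W f fc).
by exists g.
Qed.

(** * Construction of the intertwiner *)

Section Intertwiner.
Context (R : realType) (n : nat) (H KA KB : hilbertType R).
Context (iotaA : {linear H -> KA}) (V : 'I_n -> {bounded_linear KA -> KA}).
Context (iotaB : {linear H -> KB}) (W : 'I_n -> {bounded_linear KB -> KB}).
Context (c : R) (c_ge0 : 0 <= c).
Context (V_iso : forall i x, `|V i x| = `|x|).
Context (W_iso : forall i x, `|W i x| = `|x|).
Context (W_minimal :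
  closed_span [set word_op W alpha (iotaB h) | alpha in setT & h in setT]%classic = setT).
Context (word_sum_le : forall k h,
  hnorm (word_sum V k (iotaA \o h)) ^+ 2 <= c ^+ 2 * hnorm (word_sum W k (iotaB \o h)) ^+ 2).

(** A relation, since x may have several representations as a word sum. The support condition lets
    two families be summed over a common length. *)
Let graph (x : KB) (y : KA) : Prop := exists k (h : seq 'I_n -> H),
  [/\ forall w, (k < size w)%N -> h w = 0,
      x = word_sum W k (iotaB \o h) & y = word_sum V k (iotaA \o h)].

(** The closure of the graph. It stays linear and bounded by c, hence is the graph of a map;
    minimality makes that map total. *)
Let clgraph (x : KB) (y : KA) : Prop := forall e : R, 0 < e ->
  exists x' y', [/\ graph x' y', hnorm (x - x') <= e & hnorm (y - y') <= e].

Let word_op0 (K : hilbertType R) (X : 'I_n -> {bounded_linear K -> K}) w :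
  word_op X w 0 = 0.
Proof. by elim: w => [|i w IH] //=; rewrite IH linear0. Qed.

Let word_sum_widen (K : hilbertType R) (X : 'I_n -> {bounded_linear K -> K})
    (iota : {linear H -> K}) k l h : (k <= l)%N -> (forall w, (k < size w)%N -> h w = 0) ->
  word_sum X k (iota \o h) = word_sum X l (iota \o h).
Proof.
move=> kl h0; rewrite /word_sum (big_words_widen kl) // => w kw.
by rewrite /= h0 // linear0 word_op0.
Qed.

Let word_sum_lin (K : hilbertType R) (X : 'I_n -> {bounded_linear K -> K})
    (iota : {linear H -> K}) k a h h' :
  word_sum X k (iota \o (fun w => a *: h w + h' w)) =
  a *: word_sum X k (iota \o h) + word_sum X k (iota \o h').
Proof.
rewrite /word_sum scaler_sumr -big_split; apply: eq_bigr => w _ /=.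
by rewrite linearP (word_op_linear X).
Qed.

Let graph_lin a x y x' y' : graph x y -> graph x' y' -> graph (a *: x + x') (a *: y + y').
Proof.
move=> [k [h [h0 -> ->]]] [l [h' [h'0 -> ->]]].
exists (maxn k l), (fun w => a *: h w + h' w); split.
- by move=> w; rewrite gtn_max => /andP[kw lw]; rewrite h0 // h'0 // scaler0 addr0.
- by rewrite word_sum_lin -(word_sum_widen W iotaB (leq_maxl k l) h0) -(word_sum_widen W iotaB (leq_maxr k l) h'0).
- by rewrite word_sum_lin -(word_sum_widen V iotaA (leq_maxl k l) h0) -(word_sum_widen V iotaA (leq_maxr k l) h'0).
Qed.

Let graph_le x y : graph x y -> hnorm y <= c * hnorm x.
Proof.
move=> [k [h [_ -> ->]]].
by rewrite -(@ler_pXn2r _ 2) ?nnegrE ?mulr_ge0 ?hnorm_ge0 // exprMn word_sum_le.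
Qed.

Let graph_word w h : graph (word_op W w (iotaB h)) (word_op V w (iotaA h)).
Proof.
have single (K : hilbertType R) (X : 'I_n -> {bounded_linear K -> K}) (iota : {linear H -> K}) :
    word_op X w (iota h) = word_sum X (size w) (iota \o (fun a => if a == w then h else 0)).
  rewrite /word_sum (bigD1_seq w) ?mem_words ?words_uniq //= eqxx big1 ?addr0 // => a aw.
  by rewrite (negbTE aw) linear0 word_op0.
exists (size w), (fun a => if a == w then h else 0); split; [|exact: single..].
by move=> a wa; case: eqP => // aw; rewrite aw ltnn in wa.
Qed.

Let graph_shift i x y : graph x y -> graph (W i x) (V i y).
Proof.
move=> [k [h [h0 -> ->]]].
have shift (K : hilbertType R) (X : 'I_n -> {bounded_linear K -> K}) (iota : {linear H -> K}) :
    X i (word_sum X k (iota \o h)) = word_sum X k.+1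
      (iota \o (fun a => if a is j :: a' then if j == i then h a' else 0 else 0)).
  rewrite (word_sumS X) /= linear0 add0r (bigD1 i) //= [X in _ = _ + X]big1 ?addr0.
    by congr (X i _); apply: eq_bigr => w _ /=; rewrite eqxx.
  move=> j ji; rewrite /word_sum big1 ?linear0 // => w _ /=.
  by rewrite (negbTE ji) linear0 word_op0.
exists k.+1, (fun a => if a is j :: a' then if j == i then h a' else 0 else 0).
split; [|exact: shift..].
by case=> [|j a] //= ka; case: eqP => // _; rewrite h0.
Qed.

Let clgraph_sub x y : graph x y -> clgraph x y.
Proof. by move=> xy e e0; exists x, y; rewrite !subrr !hnorm0 ltW. Qed.

Let clgraph_lin a x y x' y' :
  clgraph x y -> clgraph x' y' -> clgraph (a *: x + x') (a *: y + y').
Proof.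
move=> xy xy' e e0; set A := Re `|a|.
have A0 : 0 <= A by apply: Re_ge0.
have A1 : 0 < A + 1 by lra.
have e'0 : 0 < e / (A + 1) by rewrite divr_gt0.
have [x1 [y1 [g1 hx1 hy1]]] := xy _ e'0.
have [x2 [y2 [g2 hx2 hy2]]] := xy' _ e'0.
exists (a *: x1 + x2), (a *: y1 + y2); split; first exact: graph_lin.
- rewrite opprD addrACA -scalerBr; apply: le_trans (ler_hnormD _ _) _.
  rewrite hnormZ -/A; apply: le_trans (_ : A * (e / (A + 1)) + e / (A + 1) <= _).
    by rewrite lerD // ler_wpM2l.
  by rewrite -{2}[e / _]mul1r -mulrDl mulrC divfK // gt_eqF.
- rewrite opprD addrACA -scalerBr; apply: le_trans (ler_hnormD _ _) _.
  rewrite hnormZ -/A; apply: le_trans (_ : A * (e / (A + 1)) + e / (A + 1) <= _).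
    by rewrite lerD // ler_wpM2l.
  by rewrite -{2}[e / _]mul1r -mulrDl mulrC divfK // gt_eqF.
Qed.

Let clgraph_le x y : clgraph x y -> hnorm y <= c * hnorm x.
Proof.
move=> xy; apply/ler_addgt0Pr => e e0.
have c1 : 0 < c + 1 by rewrite ltr_wpDl.
(* The approximation errors are d in y and, through the bound by c, c d from x. *)
have [d d0 dE] : exists2 d, 0 < d & d * (c + 1) = e.
  by exists (e / (c + 1)); rewrite ?divr_gt0 // divfK // gt_eqF.
have [x' [y' [g hx hy]]] := xy _ d0.
have h1 : hnorm x' <= d + hnorm x.
  by have := ler_hnormD (x' - x) x; rewrite subrK hnormBC; lra.
have := ler_hnormD (y - y') y'; rewrite subrK.
by have := graph_le g; have := ler_wpM2l c_ge0 h1; lra.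
Qed.

Let clgraph_shift i x y : clgraph x y -> clgraph (W i x) (V i y).
Proof.
move=> xy e /xy [x' [y' [g hx hy]]]; exists (W i x'), (V i y').
by split; [exact: graph_shift|rewrite -linearB /hnorm W_iso|rewrite -linearB /hnorm V_iso].
Qed.

(** If x_k tends to x, the bound by c makes the partners y_k Cauchy, and completeness of [KA]
    supplies a partner of x. *)
Let clgraph_closed x : closure [set x' | exists y', clgraph x' y']%classic x ->
  exists y, clgraph x y.
Proof.
move=> clx.
have /choice [u hu] : forall k : nat, exists p : KB * KA,
    clgraph p.1 p.2 /\ hnorm (p.1 - x) <= 1 / k.+1%:R.
  move=> k; have e0 : 0 < ((1 / k.+1%:R : R)%:C%C : R[i]) by rewrite ltcR divr_gt0.
  have [x' [[y' g]]] := clx _ (nbhsx_ballx x _ e0).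
  by rewrite -ball_normE /ball_ /= hnormE ltcR hnormBC => /ltW hx; exists (x', y').
have diff k l : clgraph ((u k).1 - (u l).1) ((u k).2 - (u l).2).
  have := clgraph_lin (-1) (proj1 (hu l)) (proj1 (hu k)).
  by rewrite !scaleN1r ![- _ + _]addrC.
have [y hy] : exists y, forall k, hnorm ((u k).2 - y) <= c / k.+1%:R.
  apply: harmonic_cauchy_cvg => k l; apply: le_trans (clgraph_le (diff k l)) _.
  rewrite -mulrDr ler_wpM2l // -[_^-1]mul1r -[X in _ <= _ + X]mul1r.
  apply: le_trans (ler_hdistD x _ _) _; apply: lerD; first by case: (hu k).
  by rewrite hnormBC; case: (hu l).
exists y => e e0.
have c1 : 0 < c + 1 by rewrite ltr_wpDl.
(* Half of e pays for replacing (x, y) by a pair [u N] with 1/(N+1) < d, at cost d in x and c d in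
   y; the other half for approximating [u N] by the graph. *)
have [d d0 dE] : exists2 d, 0 < d & d * (c + 1) = e / 2.
  by exists (e / 2 / (c + 1)); rewrite ?divr_gt0 // divfK // gt_eqF.
have [N _ /(_ N (leqnn N)) /= hN] := near_infty_natSinv_lt (PosNum d0).
have [gN hxN] := hu N; have hyN := hy N.
have e20 : 0 < e / 2 by rewrite divr_gt0.
have [x' [y' [g hx' hy']]] := gN _ e20.
have t0 : 0 < (N.+1%:R : R)^-1 by rewrite invr_gt0.
rewrite mul1r in hxN.
move: (N.+1%:R^-1) hN hxN hyN t0 => t hN hxN hyN t0.
have hc := ler_wpM2l c_ge0 (ltW hN); have cd : 0 <= c * d by rewrite mulr_ge0 // ltW.
exists x', y'; split=> //.
- by apply: le_trans (ler_hdistD (u N).1 _ _) _; rewrite hnormBC; lra.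
- by apply: le_trans (ler_hdistD (u N).2 _ _) _; rewrite hnormBC; lra.
Qed.

(** Minimality enters here: the domain is a closed subspace containing every generator W_w h. *)
Let clgraph_total x : exists y, clgraph x y.
Proof.
suff : closed_span [set word_op W w (iotaB h) | w in setT & h in setT]%classic x.
  apply: (@smallest_sub _ _ _ [set x' | exists y', clgraph x' y']%classic) => [|_ [w _ [h _ <-]]]; last first.
    by exists (word_op V w (iotaA h)); exact/clgraph_sub/graph_word.
  split; first by exists 0; rewrite -(linear0 iotaB) -(linear0 iotaA);
    exact/clgraph_sub/(graph_word [::]).
    by move=> a x1 x2 [y1 g1] [y2 g2]; exists (a *: y1 + y2); exact: clgraph_lin.
  by move=> z /clgraph_closed.
by rewrite W_minimal.
Qed.

Let clgraph_unique x y y' : clgraph x y -> clgraph x y' -> y = y'.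
Proof.
move=> g g'; have := clgraph_lin (-1) g g'; rewrite !scaleN1r addNr => /clgraph_le.
rewrite hnorm0 mulr0 => h; apply/esym/eqP; rewrite -subr_eq0 addrC; apply/eqP/hnorm0_eq0/le_anti.
by rewrite h hnorm_ge0.
Qed.

Lemma intertwiner_exists : exists L : {bounded_linear KB -> KA},
  [/\ op_norm L <= c, forall h, L (iotaB h) = iotaA h
    & forall i x, L (W i x) = V i (L x)].
Proof.
have /choice [L0 hL] := clgraph_total.
have [L LE] : exists L : {bounded_linear KB -> KA}, L =1 L0.
  apply: (@bounded_linear_pack _ _ _ _ c) => [a x y|x]; last exact: clgraph_le.
  by apply: clgraph_unique (hL _) _; exact: clgraph_lin.
exists L; split=> [|h|i x].
- by apply: op_norm_le => // x; rewrite LE; exact: clgraph_le.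
- by rewrite LE; apply: clgraph_unique (hL _) _; exact/clgraph_sub/(graph_word [::]).
- by rewrite !LE; apply: clgraph_unique (hL _) _; exact: clgraph_shift.
Qed.

End Intertwiner.

(** * Finite-rank models and the von Neumann inequality *)

Section FiniteRankModel.
Context (R : realType).

(** Infinite dimension means that no finite family spans, so some vector keeps a nonzero residual,
    which can be normalised. *)
Lemma orthonormal_exists (K : innerProductType R) : infinite_dimensional K ->
  forall d, exists f : 'I_d -> K, orthonormal_family (@inner R K) f.
Proof.
move=> Kinf; elim=> [|d [f onf]]; first by exists (fun=> 0) => -[].
have [x hx] : exists x, x - orthoproj (@inner R K) f x != 0.
  apply: contrapT => no; apply: Kinf; exists d, f => x.
  exists (fun i => inner x (f i)); apply/eqP; rewrite -subr_eq0; apply/negPn/negP => hx.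
  by apply: no; exists x.
have [|f' [of' _ _]] := orthonormal_extend (inner_psd K) onf (x := x); last by exists f'.
by apply: contra hx => /eqP /inner_eq0 ->.
Qed.

Lemma inner_norm_le (K : hilbertType R) (x y : K) :
  Re `|inner x y| <= hnorm x * hnorm y.
Proof.
rewrite -(@ler_pXn2r _ 2) ?nnegrE ?mulr_ge0 ?hnorm_ge0 ?Re_ge0 //.
have := psd_cauchy (inner_psd K) x y; rewrite -(ge0_ReK (normr_ge0 (inner x y))).
by rewrite !inner_hnorm -rmorphXn -rmorphM lecR ReC exprMn.
Qed.

Context (n : nat) (E : lmodType R[i]) (Q : E -> E -> R[i]) (Q_psd : psd_form Q).
Context (W : 'I_n -> {linear E -> E}).
Context (W_row_iso : forall i j x y, Q (W i x) (W j y) = (i == j)%:R * Q x y).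
Context (K : hilbertType R).

(** The Q-orthogonal projection onto the span of e, followed by the identification of e_a with
    f_a. *)
Let transfer d (e : 'I_d -> E) (f : 'I_d -> K) x : K := \sum_a Q x (e a) *: f a.

Let transfer_lin d (e : 'I_d -> E) (f : 'I_d -> K) a x y :
  transfer e f (a *: x + y) = a *: transfer e f x + transfer e f y.
Proof.
rewrite /transfer scaler_sumr -big_split; apply: eq_bigr => i _ /=.
by rewrite (psdDl Q_psd) (psdZl Q_psd) scalerDl scalerA.
Qed.

Let transfer_sum d (e : 'I_d -> E) (f : 'I_d -> K) (I : finType) (a : I -> R[i]) x :
  transfer e f (\sum_i a i *: x i) = \sum_i a i *: transfer e f (x i).
Proof.
rewrite /transfer; under [RHS]eq_bigr => i _ do rewrite scaler_sumr.
rewrite exchange_big; apply: eq_bigr => j _ /=.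
rewrite (psd_suml Q_psd) scaler_suml; apply: eq_bigr => i _.
by rewrite (psdZl Q_psd) scalerA.
Qed.

Let transfer_null d (e : 'I_d -> E) (f : 'I_d -> K) x : Q x x = 0 -> transfer e f x = 0.
Proof.
move=> x0; apply: big1 => a _.
by rewrite (psdC Q_psd) (psd_null Q_psd _ x0) rmorph0 scale0r.
Qed.

Let inner_transferr d (e : 'I_d -> E) (f : 'I_d -> K) y x :
  inner y (transfer e f x) = Q (\sum_b inner y (f b) *: e b) x.
Proof.
rewrite inner_sumr (psd_suml Q_psd); apply: eq_bigr => b _.
by rewrite innerZr (psdZl Q_psd) mulrC [Q (e b) x](psdC Q_psd).
Qed.

Let inner_transferl d (e : 'I_d -> E) (f : 'I_d -> K) x b :
  orthonormal_family (@inner R K) f -> inner (transfer e f x) (f b) = Q x (e b).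
Proof.
move=> onf; rewrite inner_suml (bigD1 b) //= innerZl onf eqxx mulr1 big1 ?addr0 // => a ab.
by rewrite innerZl onf (negbTE ab) mulr0.
Qed.

(* The compression of r W to the span of e, transported to the span of f and extended by 0. *)
Let model d (e : 'I_d -> E) (f : 'I_d -> K) (r : R) i (y : K) : K :=
  \sum_a (r%:C%C * inner y (f a)) *: transfer e f (W i (e a)).

Let model_adjoint d (e : 'I_d -> E) (f : 'I_d -> K) r i :
  adjoint (model e f r i) =
  fun z => \sum_a (r%:C%C * inner z (transfer e f (W i (e a)))) *: f a.
Proof.
apply: adjoint_eq => y z; rewrite inner_suml inner_sumr; apply: eq_bigr => a _.
rewrite innerZl innerZr rmorphM /= (conj_realC r) -(innerC z) -!mulrA.
by congr (_ * _); rewrite mulrC.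
Qed.

Let model_bounded d (e : 'I_d -> E) (f : 'I_d -> K) r i :
  exists X : {bounded_linear K -> K}, X =1 model e f r i.
Proof.
have [s s0 sE] : exists2 s : R, 0 <= s & `|r%:C%C : R[i]| = s%:C%C.
  by exists (Re `|r%:C%C : R[i]|); rewrite ?Re_ge0 // ge0_ReK.
apply: (@bounded_linear_pack _ _ _ _
  (\sum_a s * hnorm (f a) * hnorm (transfer e f (W i (e a))))) => [b x y|x].
  rewrite /model scaler_sumr -big_split; apply: eq_bigr => a _ /=.
  by rewrite innerDl innerZl scalerA -scalerDl; congr (_ *: _); ring.
rewrite /model mulr_suml; elim/big_ind2: _ => [|a b c d' h1 h2|a _].
- by rewrite hnorm0.
- by apply: le_trans (ler_hnormD _ _) _; exact: lerD.
- rewrite hnormZ normrM sE ReMl [leRHS]mulrAC ler_wpM2r ?hnorm_ge0 //.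
  by rewrite -mulrA ler_wpM2l // [leRHS]mulrC inner_norm_le.
Qed.

(** The vectors W_i e_a are Q-orthonormal because W is a row isometry for Q, so Bessel's inequality
    for this family controls all adjoints at once; a second Bessel inequality, for f, returns to
    |z|. *)
Let model_row_le d (e : 'I_d -> E) (f : 'I_d -> K) r z :
  orthonormal_family Q e -> orthonormal_family (@inner R K) f ->
  \sum_i hnorm (adjoint (model e f r i) z) ^+ 2 <= r ^+ 2 * hnorm z ^+ 2.
Proof.
move=> oe onf.
(* The adjoint of [transfer] applied to z. *)
pose z' := \sum_b inner z (f b) *: e b.
pose We (ia : 'I_n * 'I_d) := W ia.1 (e ia.2).
have oWe : orthonormal_family Q We.
  move=> [i a] [j b]; rewrite W_row_iso oe xpair_eqE.
  by case: (i == j); case: (a == b); rewrite ?mul0r ?mul1r.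
have bessel_z' := psd_bessel Q_psd z' oWe.
have z'_norm : Q z' z' = \sum_b `|inner z (f b)| ^+ 2.
  rewrite (psd_sumr Q_psd); apply: eq_bigr => b _.
  rewrite (psdZr Q_psd) (psd_suml Q_psd) (bigD1 b) //= (psdZl Q_psd) oe eqxx mulr1 big1.
    by rewrite addr0 normCK mulrC.
  by move=> a ab; rewrite (psdZl Q_psd) oe (negbTE ab) mulr0.
have bessel_z := psd_bessel (inner_psd K) z onf.
have E1 i : hnorm (adjoint (model e f r i) z) ^+ 2 =
    r ^+ 2 * Re (\sum_a `|Q z' (We (i, a))| ^+ 2).
  rewrite -ReMl hnorm_sqr model_adjoint; congr Re.
  rewrite inner_suml mulr_sumr; apply: eq_bigr => a _.
  rewrite innerZl [inner (f a) _]inner_sumr (bigD1 a) //= innerZr onf eqxx mulr1 big1; last first.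
    by move=> b ba; rewrite innerZr onf eq_sym (negbTE ba) mulr0.
  rewrite addr0 inner_transferr -/z' rmorphM /= (conj_realC r) normCK rmorphXn /=.
  by rewrite /We /=; ring.
rewrite (eq_bigr _ (fun i _ => E1 i)) -mulr_sumr -Re_sum ler_wpM2l ?sqr_ge0 //.
rewrite pair_bigA /= hnorm_sqr.
have := le_trans bessel_z' _; rewrite z'_norm => /(_ _ bessel_z).
by rewrite lecE => /andP[_]; congr (Re _ <= _); apply: eq_bigr => -[].
Qed.

(** Along these words the orbit of x stays in the span of e up to null vectors. Each W_i preserves
    null vectors and [transfer] kills them, so compressing loses nothing and each letter contributes
    a factor r. *)
Let model_word d (e : 'I_d -> E) (f : 'I_d -> K) r N x (X : 'I_n -> {bounded_linear K -> K}) :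
  orthonormal_family (@inner R K) f -> (forall i, X i =1 model e f r i) ->
  (forall w, (size w <= N)%N -> let y := word_op W w x in
     Q (y - orthoproj Q e y) (y - orthoproj Q e y) = 0) ->
  forall w, (size w <= N)%N ->
  word_op X w (transfer e f x) = (r ^+ size w)%:C%C *: transfer e f (word_op W w x).
Proof.
move=> onf XE null; elim=> [|i w IH] sw; first by rewrite scale1r.
rewrite /= IH ?(ltnW sw) // linearZ /= exprSr rmorphM -scalerA; congr (_ *: _).
set y := word_op W w x; have y0 := null w (ltnW sw); rewrite -/y /= in y0.
have -> : W i y = W i (y - orthoproj Q e y) + W i (orthoproj Q e y).
  by rewrite -linearD subrK.
rewrite -[W i (y - _)]scale1r transfer_lin scale1r
  [transfer e f (W i (_ - _))]transfer_null ?add0r; last first.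
  by rewrite W_row_iso y0 mulr0.
have -> : W i (orthoproj Q e y) = \sum_a Q y (e a) *: W i (e a).
  by rewrite linear_sum; apply: eq_bigr => a _; rewrite linearZ.
rewrite XE /model transfer_sum scaler_sumr; apply: eq_bigr => a _.
by rewrite inner_transferl // scalerA.
Qed.

Let sub1_exp_le (r : R) k : 0 <= r -> r <= 1 -> 0 <= 1 - r ^+ k <= k%:R * (1 - r).
Proof.
move=> r0 r1; elim: k => [|k /andP[IH1 IH2]]; first by rewrite expr0 subrr mul0r lexx.
rewrite subr_ge0 exprn_ile1 //= exprS -natr1.
have rk : 0 <= r ^+ k by rewrite exprn_ge0.
nra.
Qed.

(* Von Neumann inequality for a row of Q-isometries: on the finitely many vectors involved, the finite-rank models
   of r W on K evaluate p up to powers of r, and r tends to 1. *)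
Lemma psd_von_neumann (m : nat) (p : ncpoly R n m) (x : 'I_m -> E) :
  infinite_dimensional K -> ncpoly_Re_pos K p ->
  0 <= Re (\sum_i \sum_(w <- finsupp p) \sum_j p w i j * Q (word_op W w (x j)) (x i)).
Proof.
move=> Kinf p_pos.
pose N := \max_(w <- finsupp p) size w.
have [d [e [oe null]]] := gram_schmidt Q_psd
  [seq word_op W w (x j) | w <- words n N, j <- enum 'I_m].
have [f onf] := orthonormal_exists Kinf d.
pose z w := \sum_i \sum_j p w i j * Q (word_op W w (x j)) (x i).
have swap (a : seq 'I_n -> R[i]) :
    \sum_i \sum_(w <- finsupp p) \sum_j p w i j * (a w * Q (word_op W w (x j)) (x i)) =
    \sum_(w <- finsupp p) a w * z w.
  rewrite exchange_big; apply: eq_bigr => w _; rewrite /z mulr_sumr; apply: eq_bigr => i _.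
  by rewrite mulr_sumr; apply: eq_bigr => j _; ring.
have nullx j w : (size w <= N)%N -> let y := word_op W w (x j) in
    Q (y - orthoproj Q e y) (y - orthoproj Q e y) = 0.
  by move=> sw; apply: null; apply: allpairs_f; rewrite ?mem_words ?mem_enum.
have pos (r : R) : 0 <= r < 1 -> 0 <= \sum_(w <- finsupp p) r ^+ size w * Re (z w).
  move=> /andP[r0 r1].
  have /choice [X XE] := model_bounded e f r.
  have X1 : row_norm X < 1.
    apply: le_lt_trans r1; apply: row_norm_le => // y.
    rewrite (eq_bigr (fun i => hnorm (adjoint (model e f r i) y) ^+ 2)) ?model_row_le //.
    by move=> i _; congr (hnorm (adjoint _ y) ^+ 2); exact/funext/XE.
  have /op_Re_pos /(_ [ffun i => transfer e f (x i)]) := p_pos X X1.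
  rewrite ffun_innerE.
  have -> : \sum_i inner (ncpoly_eval p X [ffun i => transfer e f (x i)] i)
      ([ffun i => transfer e f (x i)] i) =
      \sum_(w <- finsupp p) (r ^+ size w)%:C%C * z w.
    rewrite -swap; apply: eq_bigr => i _; rewrite !ffunE inner_suml.
    rewrite !big_seq; apply: eq_bigr => w wp; rewrite inner_suml; apply: eq_bigr => j _.
    have sw : (size w <= N)%N by exact: leq_bigmax_seq.
    rewrite ffunE (model_word onf XE (nullx j) sw) !innerZl inner_transferr.
    under eq_bigr => b _ do rewrite inner_transferl //.
    rewrite -/(orthoproj Q e _); congr (_ * (_ * _)).
    (* Transferring back replaced y by its projection; the residual is null, so its pairing with x_i
       vanishes. *)
    set y := word_op W w (x j); have y0 := nullx j w sw; rewrite -/y /= in y0.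
    apply/esym/eqP; rewrite -subr_eq0 -(psdBl Q_psd) (psdC Q_psd) (psd_null Q_psd _ y0).
    by rewrite rmorph0.
  by rewrite Re_sum; under eq_bigr => w _ do rewrite ReMl.
have -> : Re (\sum_i \sum_(w <- finsupp p) \sum_j p w i j * Q (word_op W w (x j)) (x i)) =
    \sum_(w <- finsupp p) Re (z w).
  by rewrite -Re_sum exchange_big.
(* Take r = 1 - 1/(k+1): Bernoulli's inequality bounds 1 - r^|w| by |w|/(k+1), which gives this
   error constant. *)
apply: (@ler_harmonic_eps _ _ _ (\sum_(w <- finsupp p) (size w)%:R * `|Re (z w)|)) => k.
have t0 : 0 < (k.+1%:R : R)^-1 by rewrite invr_gt0.
have t1 : (k.+1%:R : R)^-1 <= 1 by rewrite invf_le1 // ler1n.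
have rk : 0 <= 1 - (k.+1%:R : R)^-1 < 1 by rewrite subr_ge0 t1 gtrBl t0.
apply: le_trans (pos _ rk) _; rewrite mulr_suml -big_split; apply: ler_sum => w _ /=.
have /andP[] := @sub1_exp_le (1 - (k.+1%:R)^-1) (size w) (proj1 (andP rk)) (ltW (proj2 (andP rk))).
rewrite opprB addrCA subrr addr0.
move: ((1 - (k.+1%:R : R)^-1) ^+ size w) ((k.+1%:R : R)^-1) ((size w)%:R : R) => a t s h1 h2.
have h3 := ler_norm (- Re (z w)); rewrite normrN in h3.
have := ler_wpM2l h1 h3; have := ler_wpM2r (normr_ge0 (Re (z w))) h2; lra.
Qed.

End FiniteRankModel.

(** * From the intertwiner to Harnack domination *)

Section Converse.
Context (R : realType) (n : nat) (K H KA KB : hilbertType R).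
Context (A B : 'I_n -> {bounded_linear H -> H}).
Context (iotaA : {linear H -> KA}) (V : 'I_n -> {bounded_linear KA -> KA}).
Context (iotaB : {linear H -> KB}) (W : 'I_n -> {bounded_linear KB -> KB}).

Lemma intertwiner_harnack (c : R) (L : {bounded_linear KB -> KA}) :
  infinite_dimensional K ->
  minimal_isometric_dilation A iotaA V -> minimal_isometric_dilation B iotaB W ->
  0 <= c -> op_norm L <= c -> (forall h, L (iotaB h) = iotaA h) ->
  (forall i x, L (W i x) = V i (L x)) -> harnack_dominated K c A B.
Proof.
move=> Kinf dilA dilB c0 Lc Liota LW m p p_pos; apply/harnack_le => f.
have Lle x : hnorm (L x) <= c * hnorm x.
  by apply: le_trans (op_norm_ge L x) _; rewrite ler_wpM2r ?hnorm_ge0.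
pose Q x y := (c ^+ 2)%:C%C * inner x y - inner (L x) (L y).
have Q_psd : psd_form Q.
  split=> [a x y z|x y|x]; rewrite /Q.
  - by rewrite linearP !innerDl !innerZl; ring.
  - by rewrite [inner y x]innerC [inner (L y) _]innerC -{1}(conj_realC (c ^+ 2)) -rmorphM -rmorphB.
  - rewrite !inner_hnorm -rmorphM -rmorphB ler0c subr_ge0 -exprMn.
    by rewrite ler_pXn2r ?nnegrE ?mulr_ge0 ?hnorm_ge0.
have VV : forall i j x y, inner (V i x) (V j y) = (i == j)%:R * inner x y.
  by case: dilA => _ isoV leV _ _; exact: row_isometry_inner.
have WW : forall i j x y, inner (W i x) (W j y) = (i == j)%:R * inner x y.
  by case: dilB => _ isoW leW _ _; exact: row_isometry_inner.
have QW i j x y : Q (W i x) (W j y) = (i == j)%:R * Q x y.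
  by rewrite /Q !LW VV WW; ring.
have := psd_von_neumann Q_psd QW (fun j => iotaB (f j)) Kinf p_pos.
have LWw w x : L (word_op W w x) = word_op V w (L x).
  by elim: w => [|i w IH] //=; rewrite LW IH.
have evalE (T : 'I_n -> {bounded_linear H -> H}) : inner (ncpoly_eval p T f) f =
    \sum_i \sum_(w <- finsupp p) \sum_j p w i j * inner (word_op T w (f j)) (f i).
  rewrite ffun_innerE; apply: eq_bigr => i _; rewrite ffunE inner_suml.
  by apply: eq_bigr => w _; rewrite inner_suml; apply: eq_bigr => j _; rewrite innerZl.
(* Both sides are now compared term by term: L fixes H and intertwines, so compressing to H turns
   Q(W_w f_j, f_i) into c^2 <B_w f_j, f_i> - <A_w f_j, f_i>. *)
move=> pos; rewrite -subr_ge0 -ReMl -ReB !evalE mulr_sumr -sumrB.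
move: pos; congr (0 <= Re _).
apply: eq_bigr => i _; rewrite mulr_sumr -sumrB; apply: eq_bigr => w _.
rewrite mulr_sumr -sumrB; apply: eq_bigr => j _.
rewrite /Q LWw !Liota (inner_word_op_dilation dilA) (inner_word_op_dilation dilB); ring.
Qed.

End Converse.

Theorem theorem1p2 (R : realType) (n : nat) (n_gt0 : (0 < n)%N)
    (K : hilbertType R) (K_infinite : infinite_dimensional K)
    (H : hilbertType R) (A B : 'I_n -> {bounded_linear H -> H})
    (A_contr : row_norm A <= 1) (B_contr : row_norm B <= 1)
    (KA : hilbertType R) (iotaA : {linear H -> KA})
    (V : 'I_n -> {bounded_linear KA -> KA})
    (V_dil : minimal_isometric_dilation A iotaA V)
    (KB : hilbertType R) (iotaB : {linear H -> KB})
    (W : 'I_n -> {bounded_linear KB -> KB})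
    (W_dil : minimal_isometric_dilation B iotaB W)
    (c : R) (c_ge1 : 1 <= c) :
  harnack_dominated K c A B <->
  exists L : {bounded_linear KB -> KA},
    [/\ op_norm L <= c,
        forall h, L (iotaB h) = iotaA h
      & forall i x, L (W i x) = V i (L x)].
Proof.
have c0 : 0 <= c := le_trans ler01 c_ge1.
split=> [AB|[L [Lc Liota LW]]]; last exact: intertwiner_harnack Lc Liota LW.
have [_ V_iso _ _ _] := V_dil; have [_ W_iso _ _ W_min] := W_dil.
by apply: intertwiner_exists => //; exact: harnack_word_sum AB.
Qed.
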